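(* Let $\mu$ be a log-concave probability measure on $\mathbb{R}$, symmetric with respect to the origin, with density $f$ that is positive on an open interval $(a_f,b_f)$ and zero outside it. Let $\Omega\subset\mathbb{R}$ be a measurable set, let $\lambda(\Omega)=\lambda_\mu(\Omega)$ be its asymmetry, and set $m(\Omega)=\min\{\mu(\Omega),\,1-\mu(\Omega)\}$. (1) If $0<\lambda(\Omega)\le m(\Omega)$, then $$P_\mu(\Omega)\ \ge\ J_\mu\big(m(\Omega)-\lambda(\Omega)/2\big)+J_\mu\big(\lambda(\Omega)/2\big).$$ (2) If $m(\Omega)<\lambda(\Omega)\le\min\big(2\,m(\Omega),\,1-m(\Omega)\big)$, then $$P_\mu(\Omega)\ \ge\ J_\mu\big(m(\Omega)+\lambda(\Omega)/2\big)+J_\mu\big(\lambda(\Omega)/2\big).$$ Moreover these inequalities are sharp: for every pair $(m,\lambda)$ with $0<m\le 1/2$ and $0<\lambda\le m$ (respectively $m<\lambda\le\min(2m,1-m)$) there is a measurable set $\Omega$ with $m(\Omega)=m$ and $\lambda(\Omega)=\lambda$ for which equality holds in (1) (respectively in (2)).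
   Context: Measure: $f$ is the density of $\mu$ with respect to Lebesgue measure $\mathcal{L}^1$; $a_f,b_f$ may be infinite; log-concave means $f=e^{-V}$ on $(a_f,b_f)$ with $V$ convex; symmetric means $f(-x)=f(x)$. Perimeter: for measurable $\Omega\subset\mathbb{R}$ and $d\in[0,1]$, $\Omega^d$ is the set of $x\in\mathbb{R}$ such that $\lim_{\rho\to0}\mathcal{L}^1(\Omega\cap B_\rho(x))/\mathcal{L}^1(B_\rho(x))=d$, where $B_\rho(x)=(x-\rho,x+\rho)$. The essential boundary is $\partial^M\Omega=\mathbb{R}\setminus(\Omega^0\cup\Omega^1)$, and the $\mu$-perimeter is $P_\mu(\Omega)=\int_{\partial^M\Omega}f\,d\mathcal{H}^0=\sum_{x\in\partial^M\Omega}f(x)\in[0,+\infty]$ ($\mathcal{H}^0$ is counting measure). Function $J_\mu$: $F$ is the cumulative distribution function of $\mu$, which is an increasing bijection from $(a_f,b_f)$ to $(0,1)$ with inverse $F^{-1}$; $J_\mu(r)=f(F^{-1}(r))$ for $r\in(0,1)$ and $J_\mu(0)=J_\mu(1)=0$. Asymmetry: $\lambda_\mu(\Omega)=\min\{\mu(\Omega\,\Delta\,(-\infty,\sigma_-)),\ \mu(\Omega\,\Delta\,(\sigma_+,+\infty))\}$, where $\sigma_-=F^{-1}(\mu(\Omega))$, $\sigma_+=F^{-1}(1-\mu(\Omega))$ and $\Delta$ is symmetric difference, with the convention $F^{-1}(0)=-\infty$, $F^{-1}(1)=+\infty$. *)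

(* Defs.v *)
From HB Require Import structures.
From mathcomp Require Import all_boot all_order all_algebra.
From mathcomp Require Import all_classical all_reals all_analysis.

Set Implicit Arguments.
Unset Strict Implicit.
Unset Printing Implicit Defensive.
Import Order.TTheory GRing.Theory Num.Theory.
Import numFieldNormedType.Exports.
Local Open Scope classical_set_scope.
Local Open Scope ring_scope.

(* [R] with the sigma-algebra of Lebesgue-measurable sets, i.e. the domain of
   [completed_lebesgue_measure]. The canonical sigma-algebra on [R : realType]
   only contains the Borel sets. *)
Notation lebesgueType R := (caratheodory_type (@wlength R idfun)^*%mu).

Section LogConcaveLine.
Context {R : realType}.

Local Notation leb := (@completed_lebesgue_measure R).

Definition open_interval (a b : \bar R) : set R :=
  [set x | (a < x%:E)%E /\ (x%:E < b)%E].

Definition has_density (mu : probability (lebesgueType R) R) (f : R -> R) :=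
  [/\ measurable_fun [set: lebesgueType R] (f : lebesgueType R -> R),
      (forall x, 0 <= f x) &
      forall A : set (lebesgueType R), measurable A ->
        mu A = (\int[leb]_(x in A) (f x)%:E)%E].

Definition log_concave_on (a b : \bar R) (f : R -> R) :=
  exists2 V : R -> R, convex_function (open_interval a b) V &
    forall x, open_interval a b x -> f x = expR (- V x).

Definition density_points (Omega : set R) (d : R) : set R :=
  [set x | (leb (Omega `&` ball x r) / leb (ball x r))%E @[r --> 0^'+]
           --> d%:E].

Definition essential_boundary (Omega : set R) : set R :=
  ~` (density_points Omega 0 `|` density_points Omega 1).

Definition perimeter (f : R -> R) (Omega : set R) : \bar R :=
  (\esum_(x in essential_boundary Omega) (f x)%:E)%E.

Section Profile.
Variables (mu : probability (lebesgueType R) R) (f : R -> R) (a b : \bar R).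

Definition mass (Omega : set R) : R := fine (mu Omega).

Definition cumul (x : R) : R := mass `]-oo, x].

(* The inverse of [cumul] as a map from the open interval (a, b) onto (0, 1);
   the value 0 given to [pinv_] is only used outside the image. *)
Definition quantile (r : R) : R := 'pinv_(fun=> 0) (open_interval a b) cumul r.

Definition equantile (r : R) : \bar R :=
  if r == 0 then -oo%E else if r == 1 then +oo%E else (quantile r)%:E.

Definition iso_profile (r : R) : R :=
  if (0 < r) && (r < 1) then f (quantile r) else 0.

Definition asymmetry (Omega : set R) : R :=
  let sigma_minus := equantile (mass Omega) in
  let sigma_plus := equantile (1 - mass Omega) in
  Num.min (mass (Omega `+` [set x | (x%:E < sigma_minus)%E]))
          (mass (Omega `+` [set x | (sigma_plus < x%:E)%E])).

Definition min_mass (Omega : set R) : R :=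
  Num.min (mass Omega) (1 - mass Omega).

End Profile.
End LogConcaveLine.

(* Main.v *)
Require Import Defs.
From HB Require Import structures.
From mathcomp Require Import all_boot all_order all_algebra finmap.
From mathcomp Require Import all_classical all_reals all_analysis.
From mathcomp Require Import measurable_realfun ring lra.
Import Order.TTheory GRing.Theory Num.Theory.
Import numFieldNormedType.Exports.
Local Open Scope classical_set_scope.
Local Open Scope ring_scope.

(** Everything is read in the coordinate r = F(x), where F is the cumulative
    distribution function.  It maps (a, b) onto (0, 1) and mu to the uniform
    measure; Omega turns into a set of length M = mu(Omega), known through its
    distribution function g(t), the mass of the part of Omega where F <= t, and
    a boundary point in position r costs J(r).

    - J is concave and symmetric about 1/2 ([iso_profile_concave_symmetric]): if
      k is a slope of a supporting line of V at z, then f + k F, whose derivative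
      is formally (k - V') f, is maximal at z.  Evenness of f gives
      F(- x) = 1 - F(x).
    - The asymmetry is 2 min (M - g(M), g(1 - M)) ([asymmetryE]): two sets of the
      same mass differ by twice the mass of either difference.
    - An interval that Omega fills with a proportion strictly between 0 and 1
      contains a point of the essential boundary
      ([essential_boundary_between]).

    Taking the complement replaces g(t) by t - g(t) and keeps the boundary, so
    M = m <= 1/2 may be assumed.  Let l be half the asymmetry, so that at least l
    is missing from Omega in (0, m), and also in (1 - m, 1).  If the perimeter is
    finite, the boundary is locally finite in (0, 1), so that on each side of any
    point Omega is locally either full or empty.  Call depth of a point r the
    number min (r, 1 - r); J increases with the depth.  Look at 1/2.

    - Omega is full on both sides.  The component (y, z) of 1/2 has length at
      most m, and both ends have depth at least l: concavity concludes
      ([optimal_sum_full_center]).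
    - Omega is empty on one side at least; let (x, z) be the gap, and suppose that
      the mass on each side of it is at least l.  Then x and z have depth at least
      l, and these depths add up to at least m ([optimal_sum_balanced]).
    - In the same situation, suppose that the mass be on the right of the gap is
      less than l.  As the part on the left has mass m - be and leaves out at
      least l, x is at least m - be + l; and the component of Omega that ends at x
      starts at some y >= l.  The point y costs at least J(l), and x costs at least
      J(m + l - be), hence at least J(m - l); moreover x and z together cost at
      least J(m + l - be) + J(be), which is at least J(m + l) by subadditivity
      ([boundary_sum_gap]).

    Equality holds for an interval whose end points have positions l and m + l in
    the second inequality, and for the complement of an interval with end points
    in positions m - l and 1 - l in the first one. *)

(** * Concave profiles symmetric about 1/2 *)

Section ConcaveProfile.
Context {R : realFieldType}.
Variable J : R -> R.

Definition concave_symmetric :=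
  [/\ (forall r, 0 <= r <= 1 -> 0 <= J r),
      (forall r, 0 <= r <= 1 -> J (1 - r) = J r) &
      (forall x y t, 0 <= x <= 1 -> 0 <= y <= 1 -> 0 <= t <= 1 ->
         t * J x + (1 - t) * J y <= J (t * x + (1 - t) * y))].

Hypothesis J_cs : concave_symmetric.

(** Moving two points towards each other, with fixed midpoint, increases the sum
    of the values of a concave function. *)
Lemma concave_spread (x y p : R) : 0 <= x -> x <= p -> p <= y -> y <= 1 ->
  J x + J y <= J p + J (x + y - p).
Proof.
case: J_cs => _ _ Jc x0 xp py y1.
have [xy|xy] := eqVneq x y.
  have -> : p = x by lra.
  by have -> : x + y - x = y by lra.
have yx : 0 < y - x by rewrite subr_gt0 lt_neqAle xy/=; lra.
pose t := (y - p) / (y - x).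
have tE : t * (y - x) = y - p by rewrite /t mulfVK ?gt_eqF.
have t01 : 0 <= t <= 1.
  by rewrite /t divr_ge0 ?ler_pdivrMr ?mul1r//=; lra.
have t01' : 0 <= 1 - t <= 1 by lra.
have hx : 0 <= x <= 1 by lra.
have hy : 0 <= y <= 1 by lra.
have := Jc x y t hx hy t01; have := Jc x y (1 - t) hx hy t01'.
have -> : t * x + (1 - t) * y = p by lra.
have -> : (1 - t) * x + (1 - (1 - t)) * y = x + y - p by lra.
lra.
Qed.

Lemma concave_symmetric_le (x y : R) : 0 <= x -> x <= y -> y <= 1 - x ->
  J x <= J y.
Proof.
move=> x0 xy yx; case: (J_cs) => _ Js _.
have := @concave_spread x (1 - x) y x0 xy yx.
have -> : x + (1 - x) - y = 1 - y by lra.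
rewrite !Js; lra.
Qed.

Lemma concave_subadditive (x y : R) : 0 <= x -> 0 <= y -> x + y <= 1 ->
  J (x + y) <= J x + J y.
Proof.
move=> x0 y0 xy; have [J0 _ _] := J_cs.
have h0 : 0 <= 0 :> R by [].
have hx : x <= x + y by lra.
have := @concave_spread 0 (x + y) x h0 x0 hx xy.
have -> : 0 + (x + y) - x = y by lra.
have := J0 0; lra.
Qed.

(** Among pairs of depths at least [l] with sum at least [s], the sum of the values
    is least for [l] and [s - l]. *)
Lemma concave_pair_ge (l s p q : R) : 0 <= l -> l <= s - l -> s <= 2^-1 ->
  l <= p -> p <= 2^-1 -> l <= q -> q <= 2^-1 -> s <= p + q ->
  J (s - l) + J l <= J p + J q.
Proof.
move=> l0 ls s2 lp p2 lq q2 spq.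
have [psl|psl] := leP (s - l) p.
  by apply: lerD; apply: concave_symmetric_le; lra.
have [qsl|qsl] := leP (s - l) q.
  by rewrite addrC; apply: lerD; apply: concave_symmetric_le; lra.
have h1 : s - l <= 1 by lra.
have := @concave_spread l (s - l) p l0 lp (ltW psl) h1.
have -> : l + (s - l) - p = s - p by lra.
have : J (s - p) <= J q by apply: concave_symmetric_le; lra.
lra.
Qed.

End ConcaveProfile.

(** * Sets of the unit interval seen through their distribution function *)

Section Distribution.
Context {R : realFieldType}.
Implicit Types (g : R -> R) (D : set R).

(** [g] is the distribution function of a set of (0, 1) and [D] its boundary.  The
    last clause, local finiteness, holds for sets of finite perimeter. *)
Definition set_profile g D :=
  [/\ g 0 = 0,
      (forall r s, 0 <= r -> r <= s -> s <= 1 -> 0 <= g s - g r <= s - r),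
      (forall r s, 0 < r -> r < s -> s < 1 -> 0 < g s - g r < s - r ->
         exists2 t, D t & r < t < s) &
      (forall t, 0 < t < 1 -> exists2 d, 0 < d &
         forall u, D u -> `|u - t| < d -> u = t)].

Lemma set_profile_compl g D : set_profile g D ->
  set_profile (fun t => t - g t) D.
Proof.
case=> g0 gl gD iD; split=> //; first by rewrite g0 subr0.
- by move=> r s r0 rs s1; have := gl r s r0 rs s1; lra.
- by move=> r s r0 rs s1 h; apply: gD => //; lra.
Qed.

Lemma set_profile_reflect g D : set_profile g D ->
  set_profile (fun t => g 1 - g (1 - t)) [set t | D (1 - t)].
Proof.
case=> g0 gl gD iD; split=> //; first by rewrite subr0 subrr.
- by move=> r s r0 rs s1; have := gl (1 - s) (1 - r); lra.
- move=> r s r0 rs s1 h.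
  have [||||t Dt ht] := gD (1 - s) (1 - r); try lra.
  exists (1 - t); last lra.
  by rewrite /= (_ : 1 - (1 - t) = t)//; lra.
- move=> t t01; have [|d d0 hd] := iD (1 - t); first lra.
  exists d => // u Du ut.
  have : 1 - u = 1 - t.
    by apply: hd => //; rewrite (_ : 1 - u - (1 - t) = - (u - t)) ?normrN//; lra.
  lra.
Qed.

(** On the right of [x] the set is empty and on the left it is not, so that every
    neighbourhood of [x] meets the boundary; local finiteness puts [x] in it. *)
Lemma plateau_start_boundary g D x c : set_profile g D ->
  0 < x -> x < c -> c <= 1 -> g x = g c ->
  (forall u, 0 <= u -> u < x -> g u < g x) -> D x.
Proof.
move=> [_ gl gD iD] x0 xc c1 gxc gu.
have [|e e0 he] := iD x; first lra.
(* small enough for [(x - d, x + d)] to stay in (0, c) and to isolate [x] *)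
pose d := Num.min e (Num.min x (c - x)) / 2.
have d0 : 0 < d by rewrite divr_gt0// !lt_min e0 x0 subr_gt0 xc.
have [de [dx dc]] : d * 2 <= e /\ d * 2 <= x /\ d * 2 <= c - x.
  by rewrite /d mulfVK// !ge_min !lexx !orbT.
have gux : g (x - d) < g x by apply: gu; lra.
have /andP[h1 h1'] : 0 <= g x - g (x - d) <= x - (x - d) by apply: gl; lra.
have /andP[h2 h2'] : 0 <= g c - g (x + d) <= c - (x + d) by apply: gl; lra.
have /andP[h3 h3'] : 0 <= g (x + d) - g x <= x + d - x by apply: gl; lra.
have [||||t Dt /andP[xt tx]] := gD (x - d) (x + d); try lra.
by rewrite -(he t Dt)// ltr_norml; lra.
Qed.

(** Between two consecutive boundary points the set is null or full. *)
Lemma left_dichotomy g D t : set_profile g D -> 0 < t < 1 ->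
  exists u, [/\ 0 <= u, u < t & g u = g t \/ u - g u = t - g t].
Proof.
move=> [_ gl gD iD] /andP[t0 t1]; have [|d d0 hd] := iD t; first by rewrite t0.
pose e := Num.min d t / 2.
have e0 : 0 < e by rewrite divr_gt0// lt_min d0 t0.
have [ed et] : e * 2 <= d /\ e * 2 <= t by rewrite /e mulfVK// !ge_min !lexx !orbT.
exists (t - e); split; [lra|lra|].
have /andP[h1 h1'] : 0 <= g t - g (t - e) <= t - (t - e) by apply: gl; lra.
(* otherwise [(t - e, t)] would contain a boundary point other than [t] *)
have [|/eqP gt0] := eqVneq (g (t - e)) (g t); first by left.
have [|/eqP gt1] := eqVneq (t - e - g (t - e)) (t - g t); first by right.
have [||||u Du /andP[ut tu]] := gD (t - e) t; [lra|lra|lra| |].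
  apply/andP; split; rewrite lt_neqAle ?h1 ?h1' andbT; apply/eqP; lra.
have : u = t by apply: hd => //; rewrite ltr_norml; lra.
lra.
Qed.

End Distribution.

Section Plateau.
Context {R : realType}.
Implicit Types (g : R -> R) (D : set R).

(** The left end of the gap that ends at [c], or [c] itself if the set is not empty
    on the left of [c].  Applied to the complement, the left end of a component. *)
Lemma plateau_start g D c : set_profile g D -> 0 <= c <= 1 ->
  exists x, [/\ 0 <= x, x <= c, g x = g c & forall u, 0 <= u -> u < x -> g u < g x].
Proof.
move=> [_ gl _ _] /andP[c0 c1].
pose S := [set t : R | 0 <= t <= c /\ g t = g c].
have S0 : has_inf S.
  split; first by exists c; split=> //; rewrite c0 lexx.
  by exists 0 => t [/andP[]].
have xc : inf S <= c.
  by apply: ge_inf; [case: S0|split=> //; rewrite c0 lexx].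
have x0 : 0 <= inf S by apply: lb_le_inf; [case: S0|move=> t [/andP[]]].
have gx : g (inf S) = g c.
  apply/eqP; rewrite eq_le; apply/andP; split.
    by have /andP[] := gl _ _ x0 xc c1; rewrite subr_ge0.
  apply/ler_addgt0Pr => e e0.
  have [t [/andP[t0 tc] tE] te] := inf_adherent e0 S0.
  have xt : inf S <= t by apply: ge_inf; [case: S0|split=> //; rewrite t0].
  by have := gl _ _ x0 xt (le_trans tc c1); lra.
exists (inf S); split=> // u u0 ux; rewrite lt_neqAle; apply/andP; split; last first.
  by have /andP[] := gl _ _ u0 (ltW ux) (le_trans xc c1); rewrite subr_ge0.
apply/eqP => gu.
suff : inf S <= u by rewrite leNgt ux.
apply: ge_inf; first by case: S0.
by split; [rewrite u0 (le_trans (ltW ux))|rewrite gu].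
Qed.

(** Since the set is not empty just before [x], it is full there. *)
Lemma full_piece_start g D x : set_profile g D -> 0 < x -> x < 1 ->
  (forall u, 0 <= u -> u < x -> g u < g x) ->
  exists y, [/\ 0 <= y, y < x, y - g y = x - g x & 0 < y -> D y].
Proof.
move=> gP x0 x1 xs; have hP := set_profile_compl _ _ gP.
have [|u [u0 ux hu]] := left_dichotomy _ _ x gP; first by rewrite x0.
have {}hu : u - g u = x - g x by case: hu => // gu; have := xs u u0 ux; rewrite gu ltxx.
have [|y [y0 yx hy ys]] := plateau_start _ _ x hP; first by rewrite !ltW.
have {}yx : y < x.
  rewrite lt_neqAle yx andbT; apply/eqP => yE.
  by have := ys u u0; rewrite yE => /(_ ux); rewrite hu ltxx.
exists y; split=> // y0'.
by apply: (plateau_start_boundary _ _ y x hP) => //; exact: ltW.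
Qed.

End Plateau.

(** * The lower bound *)

Section LowerBound.
Context {R : realFieldType}.
Implicit Types (g : R -> R) (D : set R).
Variable J : R -> R.
Hypothesis J_cs : concave_symmetric J.

(** Finitely many points suffice to bound the perimeter from below, and the
    argument never uses more than three. *)
Definition boundary_sum_ge D T :=
  exists s : seq R, [/\ uniq s, (forall x, x \in s -> D x) & T <= \sum_(x <- s) J x].

Lemma boundary_sum_ge2 D T x y : D x -> D y -> x < y ->
  T <= J x + J y -> boundary_sum_ge D T.
Proof.
move=> Dx Dy xy h; exists [:: x; y]; split.
- by rewrite /= inE lt_eqF.
- by move=> z; rewrite !inE => /orP[]/eqP->.
- by rewrite !big_cons big_nil addr0.
Qed.

Lemma boundary_sum_ge3 D T x y z : D x -> D y -> D z -> x < y -> y < z ->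
  T <= J x + J y + J z -> boundary_sum_ge D T.
Proof.
move=> Dx Dy Dz xy yz h; exists [:: x; y; z]; split.
- by rewrite /= !inE !lt_eqF// (lt_trans xy).
- by move=> u; rewrite !inE => /or3P[]/eqP->.
- by rewrite !big_cons big_nil addr0 addrA.
Qed.

Lemma boundary_sum_ge_reflect D T : D `<=` [set t | 0 <= t <= 1] ->
  boundary_sum_ge [set t | D (1 - t)] T -> boundary_sum_ge D T.
Proof.
have [_ Js _] := J_cs.
move=> D01 [s [us sD Ts]]; exists [seq 1 - x | x <- s]; split.
- by rewrite map_inj_uniq// => x y /=; lra.
- by move=> x /mapP[y ys ->]; exact: sD.
- rewrite big_map (le_trans Ts)// le_eqVlt; apply/orP; left; apply/eqP.
  rewrite big_seq [RHS]big_seq; apply: eq_bigr => y /sD /D01 /= y01.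
  by rewrite Js//; lra.
Qed.

(** The right-hand sides of both inequalities, [l] being half the asymmetry. *)
Definition optimal_sum (m l : R) :=
  if l <= m / 2 then J (m - l) + J l else J (m + l) + J l.

(** The last condition is the bound of the asymmetry by [1 - m]; for [l <= m / 2]
    it follows from the others. *)
Definition admissible (m l : R) := [&& 0 < l, l <= m, m <= 2^-1 & l <= (1 - m) / 2].

(** For [l > m / 2] the worst case is an interval of length exactly [m]: then
    [J y + J (y + m)] is concave in [y], symmetric about [(1 - m) / 2], and takes
    the value [optimal_sum m l] at both ends of the range allowed to [y]. *)
Lemma optimal_sum_full_center (m l y z : R) : admissible m l ->
  y < 2^-1 -> 2^-1 < z -> z - y <= m -> l <= y -> l <= 1 - z ->
  optimal_sum m l <= J y + J z.
Proof.
move=> /and4P[l0 lm m2 lm2] y2 z2 zy yl zl.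
have [_ Js _] := J_cs.
have -> : J z = J (1 - z) by rewrite Js//; lra.
rewrite /optimal_sum; case: ifPn => [lm1|]; [|rewrite -ltNge => lm1].
  by apply: concave_pair_ge => //; lra.
have -> : J (m + l) = J (1 - (m + l)) by rewrite Js//; lra.
have [hy|hy] := leP (1 - (m + l)) y.
  by apply: lerD; apply: concave_symmetric_le => //; lra.
have := concave_spread _ J_cs l (1 - (m + l)) y (ltW l0) yl (ltW hy).
have -> : l + (1 - (m + l)) - y = 1 - m - y by lra.
suff : J (1 - m - y) <= J (1 - z) by lra.
by apply: concave_symmetric_le => //; lra.
Qed.

(** The gap is [(x, z)], [be] the mass on its right, and [y] the start of the
    component that ends at [x].  When [z] is not a boundary point, [be = 0] and
    the points [y] and [x] are enough. *)
Lemma boundary_sum_gap D (m l be y x z : R) : admissible m l ->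
  D y -> D x -> (z < 1 -> D z) -> y < x -> x < z -> x <= 2^-1 -> 2^-1 <= z ->
  0 <= be -> be < l -> l <= y -> m - be + l <= x -> be <= 1 - z ->
  boundary_sum_ge D (optimal_sum m l).
Proof.
move=> /and4P[l0 lm m2 lm2] Dy Dx Dz yx xz x2 z2 be0 bel ly lx bz.
have [J0 Js _] := J_cs.
have Jy : J l <= J y by apply: concave_symmetric_le => //; lra.
rewrite /optimal_sum; case: ifPn => [lm1|_].
  apply: (boundary_sum_ge2 _ _ _ _ Dy Dx yx); rewrite addrC lerD//.
  by apply: concave_symmetric_le => //; lra.
have [z1|z1] := ltP z 1; last first.
  apply: (boundary_sum_ge2 _ _ _ _ Dy Dx yx); rewrite addrC lerD//.
  by apply: concave_symmetric_le => //; lra.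
apply: (boundary_sum_ge3 _ _ _ _ _ Dy Dx (Dz z1)) => //.
rewrite addrC -addrA lerD//.
apply: (@le_trans _ _ (J (m + l - be) + J be)).
  rewrite -{1}(subrK be (m + l)).
  by apply: concave_subadditive => //; lra.
have -> : J z = J (1 - z) by rewrite Js//; lra.
by apply: lerD; apply: concave_symmetric_le => //; lra.
Qed.

Lemma optimal_sum_balanced (m l x z : R) : admissible m l ->
  x <= 2^-1 -> 2^-1 <= z -> l <= x -> l <= 1 - z -> l + l <= m -> m <= x + (1 - z) ->
  optimal_sum m l <= J x + J z.
Proof.
move=> /and4P[l0 lm m2 lm2] x2 z2 lx lz ll mxz; have [_ Js _] := J_cs.
rewrite /optimal_sum; have -> : l <= m / 2 by lra.
have -> : J z = J (1 - z) by rewrite Js//; lra.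
by apply: concave_pair_ge => //; lra.
Qed.

End LowerBound.

Section ProfileLowerBound.
Context {R : realType}.
Implicit Types (g : R -> R) (D : set R).
Variable J : R -> R.
Hypothesis J_cs : concave_symmetric J.

(** Being beyond [m], the gap starts after everything that is missing in [(0, m)]:
    the missing length before [x], which is also the one before the component
    that ends at [x], is at least [l]. *)
Lemma gap_lower_bound g D m l x z : set_profile g D -> admissible m l ->
  g 1 = m -> l <= m - g m ->
  0 <= x -> x <= 2^-1 -> 2^-1 <= z -> z <= 1 -> x < z -> g x = g z ->
  (0 < x -> D x) -> (z < 1 -> D z) -> (forall u, 0 <= u -> u < x -> g u < g x) ->
  m - g z < l -> boundary_sum_ge J D (optimal_sum J m l).
Proof.
move=> gP ml g1 lL x0 x2 z2 z1 xz gxz Dx Dz xs bl.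
have [g0 gl _ _] := gP; have /and4P[l0 lm m2 lm2] := ml.
have mx : m < x.
  rewrite ltNge; apply/negP => xm; have := gl x m x0 xm; lra.
have xlt1 : x < 1 by lra.
have m0 : 0 <= m by lra.
have h1 := gl m x m0 (ltW mx) (ltW xlt1).
have [y [y0 yx hy Dy]] := full_piece_start _ _ _ gP (le_lt_trans m0 mx) xlt1 xs.
have h2 := gl 0 y (lexx 0) y0 (ltW (lt_trans yx xlt1)).
have h3 := gl z 1 (le_trans x0 (ltW xz)) z1 (lexx 1).
have ly : l <= y by clear h3; lra.
apply: (boundary_sum_gap _ J_cs D m l (m - g z) y x z) => //; try lra.
- by apply: Dy; lra.
- by apply: Dx; lra.
Qed.

(** The gap around 1/2 lies between [x] and [1 - z'], found by [plateau_start] on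
    either side; when the gap is empty, both sides of 1/2 are full.  A gap with
    little mass on its left is seen after reflection. *)
Lemma profile_lower_bound g D m l : D `<=` [set t | 0 <= t <= 1] ->
  set_profile g D -> admissible m l -> g 1 = m ->
  l <= m - g m -> l <= g (1 - m) -> boundary_sum_ge J D (optimal_sum J m l).
Proof.
move=> D01 gP ml g1 lL lR.
have [g0 gl _ _] := gP.
have rP := set_profile_reflect _ _ gP.
have hP := set_profile_compl _ _ gP.
have hrP := set_profile_reflect _ _ hP.
have /andP[c0 c1] : 0 < (2^-1 : R) < 1 by lra.
have c01 : 0 <= (2^-1 : R) <= 1 by rewrite !ltW.
have c01' : 0 < (2^-1 : R) < 1 by rewrite c0.
have cE : 1 - 2^-1 = 2^-1 :> R by lra.
have [x [x0 x2 gx xs]] := plateau_start _ _ _ gP c01.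
have /= [z' [z0 z2 gz zs]] := plateau_start _ _ _ rP c01.
have {}gz : g (1 - z') = g 2^-1 by rewrite cE in gz; lra.
have cz : 2^-1 <= 1 - z' by lra.
have z1 : 1 - z' <= 1 by lra.
have gxz : g x = g (1 - z') by rewrite gx gz.
have [xz|xz] := ltP x (1 - z').
  have zK : 1 - (1 - x) = x by lra.
  have Dx : 0 < x -> D x.
    by move=> x0'; apply: (plateau_start_boundary _ _ _ (1 - z') gP).
  have Dz : 0 < z' -> D (1 - z').
    move=> z0'; apply: (plateau_start_boundary _ _ z' (1 - x) rP) => //=; [lra|lra|].
    by rewrite zK gxz.
  have Dz' : 1 - z' < 1 -> D (1 - z') by move=> ?; apply: Dz; lra.
  have [al|al] := ltP (g x) l.
    apply: boundary_sum_ge_reflect => //.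
    apply: (gap_lower_bound _ _ m l z' (1 - x) rP) => //=; rewrite ?zK//.
    - by rewrite subrr g0 subr0.
    - by rewrite g1; lra.
    - lra.
    - lra.
    - lra.
    - by rewrite gxz.
    - by move=> ?; apply: Dx; lra.
    - by rewrite g1; lra.
  have [bl|bl] := ltP (m - g (1 - z')) l.
    exact: (gap_lower_bound _ _ m l x (1 - z') gP).
  have h1 := gl 0 x (lexx 0) x0 (le_trans x2 (ltW c1)).
  have h2 := gl (1 - z') 1 (le_trans x0 (ltW xz)) z1 (lexx 1).
  have /and4P[l0 _ _ _] := ml.
  have lx : l <= x by lra.
  apply: (boundary_sum_ge2 _ _ _ x (1 - z')) => //; [by apply: Dx; lra|by apply: Dz; lra|].
  by apply: optimal_sum_balanced => //; lra.
have {}xE : x = 2^-1 by lra.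
have {}zE : z' = 2^-1 by lra.
have [y [y0 y2 hy Dy]] : exists y, [/\ 0 <= y, y < 2^-1, y - g y = 2^-1 - g 2^-1 & 0 < y -> D y].
  by rewrite -xE; apply: (full_piece_start _ _ _ gP); rewrite // xE.
have /= [w [w0 w2 hw Dw]] : exists w, [/\ 0 <= w, w < 2^-1,
    w - (g 1 - g (1 - w)) = 2^-1 - (g 1 - g (1 - 2^-1)) & 0 < w -> D (1 - w)].
  have z0' : 0 < z' by rewrite zE.
  have z1' : z' < 1 by rewrite zE.
  by have := full_piece_start _ _ _ rP z0' z1' zs; rewrite /= zE.
rewrite cE g1 in hw.
have /and4P[l0 lm m2 lm2] := ml.
have m0 : 0 <= m by lra.
have wc : 2^-1 < 1 - w by lra.
have h1 := gl m 2^-1 m0 m2 (ltW c1).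
have h2 := gl 2^-1 (1 - m) (ltW c0).
have h3 := gl (1 - w) 1 (ltW (lt_trans c0 wc)) _ (lexx 1).
have h4 := gl 0 y (lexx 0) y0 (ltW (lt_trans y2 c1)).
have yl : l <= y by clear h2 h3; lra.
have wl : l <= w by clear h1 h4; lra.
apply: (boundary_sum_ge2 _ _ _ y (1 - w)); [by apply: Dy; lra|by apply: Dw; lra|lra|].
by apply: optimal_sum_full_center => //; lra.
Qed.

End ProfileLowerBound.

(** * The essential boundary on the line *)

(** Let [th] be the average slope of [G].  The function [G t - th * t] takes the
    same value at both ends, so it has an interior extremum [x].  There the mean
    slopes of [G] on the left and on the right of [x] lie on opposite sides of
    [th], and between 0 and 1, so that their average stays away from 0 and 1. *)
Lemma increment_extremum {R : realType} (G : R -> R) (u v : R) : u < v ->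
  (forall s t, s <= t -> 0 <= G t - G s <= t - s) ->
  0 < G v - G u < v - u ->
  exists x c, [/\ u < x < v, 0 < c & forall r, 0 < r -> u <= x - r -> x + r <= v ->
     c * r <= G (x + r) - G (x - r) <= (2 - c) * r].
Proof.
move=> uv Gl Guv.
pose th := (G v - G u) / (v - u).
have vu0 : 0 < v - u by rewrite subr_gt0.
have thE : th * (v - u) = G v - G u by rewrite /th mulfVK ?gt_eqF.
have th01 : 0 < th < 1.
  rewrite /th divr_gt0//=; last by case/andP: Guv.
  by rewrite ltr_pdivrMr ?mul1r; case/andP: Guv.
pose H t := G t - th * t.
have HE : H u = H v by rewrite /H; lra.
have HL s t : `|H t - H s| <= `|t - s|.
  wlog st : s t / s <= t => [hw|].
    have [st|/ltW ts] := leP s t; first exact: hw.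
    by rewrite distrC [leRHS]distrC; exact: hw.
  rewrite (ger0_norm (_ : 0 <= t - s)); last lra.
  have Gst : 0 <= G t - G s <= t - s by apply: Gl.
  have h1 : 0 <= th * (t - s) by apply: mulr_ge0; lra.
  have h2 : 0 <= (1 - th) * (t - s) by apply: mulr_ge0; lra.
  by rewrite /H ler_norml; lra.
have Hc : {within `[u, v], continuous H}.
  apply: continuous_subspaceT => x; apply/cvgrPdist_lt => e e0.
  near=> y; apply: le_lt_trans (HL y x) _.
  by near: y; exact: cvgr_dist_lt.
have : exists2 x, u < x < v &
  (forall t, u <= t <= v -> H t <= H x) \/ (forall t, u <= t <= v -> H x <= H t).
  have [x] := EVT_max (ltW uv) Hc; rewrite in_itv/= => xuv xM.
  have [y] := EVT_min (ltW uv) Hc; rewrite in_itv/= => yuv ym.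
  have {}xM t : u <= t <= v -> H t <= H x by move=> tuv; apply: xM; rewrite in_itv.
  have {}ym t : u <= t <= v -> H y <= H t by move=> tuv; apply: ym; rewrite in_itv.
  have [xI|xI] := boolP (u < x < v); first by exists x => //; left.
  have [yI|yI] := boolP (u < y < v); first by exists y => //; right.
  have Hx : H x = H u.
    by move: xI; have [-> //|xu] := eqVneq x u; have [-> //|xv] := eqVneq x v;
      rewrite !lt_neqAle eq_sym xu xv/= xuv.
  have Hy : H y = H u.
    by move: yI; have [-> //|yu] := eqVneq y u; have [-> //|yv] := eqVneq y v;
      rewrite !lt_neqAle eq_sym yu yv/= yuv.
  exists ((u + v) / 2); first lra.
  by left=> t /xM; rewrite Hx -Hy => /le_trans; apply; apply: ym; lra.
move=> [x xuv xE]; exists x, (Num.min th (1 - th)); split=> //.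
  by rewrite lt_min; lra.
move=> r r0 ur rv.
have cr : Num.min th (1 - th) * r <= th * r /\
          Num.min th (1 - th) * r <= (1 - th) * r.
  by rewrite !ler_pM2r// !ge_min !lexx orbT.
have g1 : 0 <= G x - G (x - r) <= x - (x - r) by apply: Gl; lra.
have g2 : 0 <= G (x + r) - G x <= x + r - x by apply: Gl; lra.
have xr1 : u <= x - r <= v by lra.
have xr2 : u <= x + r <= v by lra.
by case: xE => xE; have := xE _ xr1; have := xE _ xr2; rewrite /H; lra.
Unshelve. all: by end_near.
Qed.

Section FineMeasure.
Context d (T : measurableType d) (R : realType) (nu : {measure set T -> \bar R}).

Lemma fine_measureU (A B : set T) : measurable A -> measurable B ->
  (nu A < +oo)%E -> (nu B < +oo)%E -> A `&` B = set0 ->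
  fine (nu (A `|` B)) = fine (nu A) + fine (nu B).
Proof.
by move=> mA mB Aoo Boo AB; rewrite measureU// fineD// ge0_fin_numE.
Qed.

Lemma fine_measure_ge0 (A : set T) : 0 <= fine (nu A).
Proof. exact/fine_ge0. Qed.

Lemma le_fine_measure (A B : set T) : measurable A -> measurable B ->
  (nu B < +oo)%E -> A `<=` B -> fine (nu A) <= fine (nu B).
Proof.
move=> mA mB Boo AB; have nAB : (nu A <= nu B)%E by apply: le_measure; rewrite ?inE.
by rewrite fine_le// ge0_fin_numE// (le_lt_trans nAB).
Qed.

End FineMeasure.

Section LebesgueLine.
Context {R : realType}.
Local Notation leb := (@completed_lebesgue_measure R).

Lemma measurable_lebesgue_itv (i : interval R) :
  measurable ([set` i] : set (lebesgueType R)).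
Proof. by apply: sub_caratheodory; exact: measurable_itv. Qed.

Lemma lebesgue_itv (u v : R) (x y : bool) : u <= v ->
  leb [set` Interval (BSide x u) (BSide y v)] = (v - u)%:E.
Proof.
move=> uv; have := @lebesgue_measure_itv R (Interval (BSide x u) (BSide y v)).
rewrite /= lte_fin => lE; rewrite [LHS]lE; case: ifPn => //; rewrite -leNgt => vu.
have -> : v = u by apply/eqP; rewrite eq_le vu uv.
by rewrite subrr.
Qed.

Lemma lebesgue_set1 (x : R) : leb [set x] = 0%E.
Proof. by have := @lebesgue_measure_set1 R x. Qed.

(** Half-open intervals make this additive; the balls that define densities are
    open, which changes nothing up to a null set. *)
Definition leb_portion (O : set R) (u v : R) := fine (leb (O `&` `]u, v])).

Variable O : set (lebesgueType R).
Hypothesis mO : measurable O.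

Lemma measurable_portion (i : interval R) : measurable (O `&` [set` i]).
Proof. by apply: measurableI => //; exact: measurable_lebesgue_itv. Qed.

Lemma lebesgue_itv_lty (u v : R) (x y : bool) :
  (leb [set` Interval (BSide x u) (BSide y v)] < +oo)%E.
Proof.
have := @lebesgue_measure_itv R (Interval (BSide x u) (BSide y v)).
by rewrite /= => lE; rewrite [ltLHS]lE; case: ifP => // _; exact: ltry.
Qed.

Lemma portion_lty (u v : R) (x y : bool) :
  (leb (O `&` [set` Interval (BSide x u) (BSide y v)]) < +oo)%E.
Proof.
apply: le_lt_trans (lebesgue_itv_lty u v x y).
by apply: le_measure; rewrite ?inE; [exact: measurable_portion|
  exact: measurable_lebesgue_itv|move=> ? []].
Qed.

Lemma leb_portion_bounds u v : u <= v -> 0 <= leb_portion O u v <= v - u.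
Proof.
move=> uv; rewrite fine_measure_ge0/=.
have <- : fine (leb `]u, v]) = v - u by rewrite lebesgue_itv.
by apply: le_fine_measure; [exact: measurable_portion|exact: measurable_lebesgue_itv|
  exact: lebesgue_itv_lty|move=> ? []].
Qed.

Lemma leb_portionD u v w : u <= v -> v <= w ->
  leb_portion O u w = leb_portion O u v + leb_portion O v w.
Proof.
move=> uv vw.
rewrite /leb_portion (itv_bndbnd_setU (_ : BRight u <= BRight v)%O (_ : _ <= BRight w)%O)//.
rewrite setIUr; apply: fine_measureU; try exact: measurable_portion;
  try exact: portion_lty.
by apply/seteqP; split=> // x [[_ /=]]; rewrite in_itv/= => h [_ /=]; rewrite in_itv/=; lra.
Qed.

Lemma lebesgue_ball_portion x r : 0 < r ->
  leb (O `&` ball x r) = (leb_portion O (x - r) (x + r))%:E.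
Proof.
move=> r0; rewrite /leb_portion fineK ?ge0_fin_numE ?portion_lty// ball_itv.
apply/eqP; rewrite eq_le; apply/andP; split.
  apply: le_measure; rewrite ?inE; try exact: measurable_portion.
  by apply: setIS => y /=; rewrite !in_itv/= => /andP[-> /ltW].
rewrite -[leRHS]adde0 -(lebesgue_set1 (x + r)).
have m1 : measurable ([set x + r] : set (lebesgueType R)).
  by apply: sub_caratheodory; exact: measurable_set1.
apply: le_trans (measureU2 _ (measurable_portion _) m1).
apply: le_measure; rewrite ?inE; [exact: measurable_portion| |].
  by apply: measurableU => //; exact: measurable_portion.
move=> y [Oy /=]; rewrite in_itv/= => /andP[yl].
by rewrite le_eqVlt => /predU1P[->|yr]; [right|left; split=> //=; rewrite in_itv/= yl].
Qed.

Lemma lebesgue_ball_ratio x r : 0 < r ->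
  (leb (O `&` ball x r) / leb (ball x r))%E =
  (leb_portion O (x - r) (x + r) / (r *+ 2))%:E.
Proof.
move=> r0; rewrite lebesgue_ball_portion//.
have -> : leb (ball x r) = (r *+ 2)%:E.
  by rewrite ball_itv lebesgue_itv; [congr (_%:E)|]; lra.
by rewrite inver gt_eqF ?mulrn_wgt0// -EFinM.
Qed.

Lemma leb_portion_cumul u s t : s <= t ->
  0 <= leb_portion O u t - leb_portion O u s <= t - s.
Proof.
have L0 y : y <= u -> leb_portion O u y = 0.
  by move=> yu; rewrite /leb_portion set_itv_ge ?bnd_simp -?leNgt// setI0 measure0.
move=> st; have [us|su] := leP u s.
  by rewrite (leb_portionD _ _ _ us st) addrAC subrr add0r leb_portion_bounds.
rewrite (L0 s (ltW su)) subr0; have [ut|tu] := leP u t.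
  by have := leb_portion_bounds _ _ ut; lra.
by rewrite (L0 t (ltW tu)); lra.
Qed.

(** At the point given by [increment_extremum], the proportion of [O] in small balls
    stays away from 0 and 1. *)
Lemma essential_boundary_between u v : u < v ->
  0 < leb_portion O u v < v - u ->
  exists2 x, essential_boundary O x & u < x < v.
Proof.
move=> uv muv.
have [|x [c [xuv c0 xc]]] := increment_extremum (leb_portion O u) u v uv (leb_portion_cumul u).
  by rewrite {2 4}/leb_portion set_itv_ge ?bnd_simp ?ltxx// setI0 measure0 subr0.
exists x => //.
have ratio : \forall r \near 0^'+,
    ((c / 2)%:E <= leb (O `&` ball x r) / leb (ball x r) <= (1 - c / 2)%:E)%E.
  near=> r.
  have r0 : 0 < r by near: r; exact: nbhs_right_gt.
  have ru : r <= x - u by near: r; apply: nbhs_right_le; lra.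
  have rv : r <= v - x by near: r; apply: nbhs_right_le; lra.
  have := xc r r0; rewrite lebesgue_ball_ratio// !lee_fin.
  rewrite (leb_portionD u (x - r)); [|lra|lra].
  rewrite addrAC subrr add0r ler_pdivlMr ?mulrn_wgt0// ler_pdivrMr ?mulrn_wgt0//.
  by lra.
case; rewrite /density_points/= => xd.
  have : ((c / 2)%:E <= 0%:E :> \bar R)%E.
    by apply: (cvge_to_ge xd); apply: filterS ratio => r /andP[].
  by rewrite lee_fin; lra.
have : (1%:E <= (1 - c / 2)%:E :> \bar R)%E.
  by apply: (cvge_to_le xd); apply: filterS ratio => r /andP[].
by rewrite lee_fin; lra.
Unshelve. all: by end_near.
Qed.

Lemma essential_boundary_local x e : 0 < e ->
  (ball x e `<=` O) \/ (ball x e `<=` ~` O) -> ~ essential_boundary O x.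
Proof.
move=> e0 h; apply; case: h => h; [right|left]; rewrite /density_points/=.
  apply: cvg_near_cst; near=> r.
  have r0 : 0 < r by near: r; exact: nbhs_right_gt.
  have re : r <= e by near: r; exact: nbhs_right_le.
  rewrite setIidr; last exact: subset_trans (le_ball re) h.
  rewrite ball_itv lebesgue_itv; last lra.
  by rewrite divee// eqe gt_eqF//; lra.
apply: cvg_near_cst; near=> r.
have r0 : 0 < r by near: r; exact: nbhs_right_gt.
have re : r <= e by near: r; exact: nbhs_right_le.
rewrite (_ : O `&` ball x r = set0) ?measure0 ?mul0e//.
apply/seteqP; split=> // y [Oy yr]; apply: (h y) => //; exact: le_ball yr.
Unshelve. all: by end_near.
Qed.

End LebesgueLine.

Section IntervalBoundary.
Context {R : realType}.
Local Notation leb := (@completed_lebesgue_measure R).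

Lemma leb_portionC (O : set (lebesgueType R)) u v : measurable O -> u <= v ->
  leb_portion (~` O) u v = v - u - leb_portion O u v.
Proof.
move=> mO uv; suff : leb_portion O u v + leb_portion (~` O) u v = v - u by lra.
rewrite /leb_portion -fine_measureU.
- by transitivity (fine (leb `]u, v])); [rewrite -setIUl setUCr setTI|rewrite lebesgue_itv].
- exact: measurable_portion.
- by apply: measurable_portion; exact: measurableC.
- exact: portion_lty.
- by apply: portion_lty; exact: measurableC.
- by apply/seteqP; split=> // x [[? _] [? _]].
Qed.

(** Each end point is found as the only candidate in a neighbourhood that the set
    neither fills nor avoids. *)
Lemma essential_boundary_two_points (O : set (lebesgueType R)) s t : measurable O -> s < t ->
  (forall x, x != s -> x != t ->
     exists2 e, 0 < e & (ball x e `<=` O) \/ (ball x e `<=` ~` O)) ->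
  (forall e, 0 < e -> e < t - s -> 0 < leb_portion O (s - e) (s + e) < e *+ 2 /\
                                  0 < leb_portion O (t - e) (t + e) < e *+ 2) ->
  essential_boundary O = [set s; t].
Proof.
move=> mO st Oloc Omix.
have sub x : essential_boundary O x -> x = s \/ x = t.
  move=> bx; have [->|xs] := eqVneq x s; first by left.
  have [->|xt] := eqVneq x t; first by right.
  have [e e0 xe] := Oloc x xs xt.
  by case: (essential_boundary_local _ x e e0 xe).
pose e := (t - s) / 2.
have e0 : 0 < e by rewrite /e; lra.
have et : e < t - s by rewrite /e; lra.
have [s_mix t_mix] := Omix e e0 et.
apply/seteqP; split=> x; first exact: sub.
case=> ->.
- have [||y by_ ys] := essential_boundary_between O mO (s - e) (s + e); [lra|lra|].
  by have [<-//|yt] := sub y by_; move: ys; rewrite yt /e; lra.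
- have [||y by_ yt] := essential_boundary_between O mO (t - e) (t + e); [lra|lra|].
  by have [ys|<-//] := sub y by_; move: yt; rewrite ys /e; lra.
Qed.

Lemma itv_oc_local (s t x : R) : x != s -> x != t ->
  exists2 e, 0 < e & (ball x e `<=` `]s, t]) \/ (ball x e `<=` ~` `]s, t]).
Proof.
move=> xs xt; exists (Num.min `|x - s| `|x - t|).
  by rewrite lt_min !normr_gt0 !subr_eq0 xs.
have inball y : ball x (Num.min `|x - s| `|x - t|) y -> `|x - y| < `|x - s| /\ `|x - y| < `|x - t|.
  by rewrite /ball/= lt_min => /andP[].
have [sx|sx] := ltP s x; have [tx|tx] := ltP x t.
- left=> y /inball; rewrite /= in_itv/= (gtr0_norm (_ : 0 < x - s)) ?subr_gt0//.
  by rewrite (ltr0_norm (_ : x - t < 0)) ?subr_lt0// !ltr_norml; lra.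
- right=> y /inball; rewrite /= in_itv/= (gtr0_norm (_ : 0 < x - s)) ?subr_gt0//.
  by rewrite (ger0_norm (_ : 0 <= x - t)) ?subr_ge0// !ltr_norml; lra.
- right=> y /inball; rewrite /= in_itv/= (ler0_norm (_ : x - s <= 0)) ?subr_le0//.
  by rewrite (ltr0_norm (_ : x - t < 0)) ?subr_lt0// !ltr_norml; lra.
- right=> y /inball; rewrite /= in_itv/= (ler0_norm (_ : x - s <= 0)) ?subr_le0//.
  by rewrite (ger0_norm (_ : 0 <= x - t)) ?subr_ge0// !ltr_norml; lra.
Qed.

Lemma leb_portion_itv_ends (s t e : R) : 0 < e -> e < t - s ->
  leb_portion `]s, t] (s - e) (s + e) = e /\ leb_portion `]s, t] (t - e) (t + e) = e.
Proof.
move=> e0 et; rewrite /leb_portion; split.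
  rewrite (_ : _ `&` _ = `]s, s + e]%classic).
    by rewrite lebesgue_itv/=; lra.
  by apply/seteqP; split=> x /=; rewrite !in_itv/=; lra.
rewrite (_ : _ `&` _ = `]t - e, t]%classic).
  by rewrite lebesgue_itv/=; lra.
by apply/seteqP; split=> x /=; rewrite !in_itv/=; lra.
Qed.

Lemma essential_boundary_itv (s t : R) : s < t -> essential_boundary `]s, t] = [set s; t].
Proof.
move=> st; apply: essential_boundary_two_points => //.
- exact: measurable_lebesgue_itv.
- by move=> x; exact: itv_oc_local.
- by move=> e e0 /(leb_portion_itv_ends _ _ _ e0)[-> ->]; lra.
Qed.

Lemma essential_boundary_itvC (s t : R) : s < t -> essential_boundary (~` `]s, t]) = [set s; t].
Proof.
move=> st.
have mst : measurable (`]s, t]%classic : set (lebesgueType R)) by exact: measurable_lebesgue_itv.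
apply: essential_boundary_two_points => //.
- exact: measurableC.
- by move=> x xs xt; have [e e0 h] := itv_oc_local s t x xs xt; exists e => //;
    rewrite setCK or_comm.
- move=> e e0 et; rewrite !leb_portionC//; try lra.
  by have [-> ->] := leb_portion_itv_ends _ _ _ e0 et; lra.
Qed.

End IntervalBoundary.

(** * Log-concave densities *)

Section Derivatives.
Context {R : realType}.

Lemma is_derive_nonneg_le (Q dQ : R -> R) (s t : R) : s <= t ->
  (forall x, s <= x <= t -> is_derive x 1 Q (dQ x) /\ 0 <= dQ x) -> Q s <= Q t.
Proof.
move=> st h.
have [x xst||c cst QE] := @MVT_segment _ Q dQ s t st.
- by apply: (h x _).1; move: xst; rewrite in_itv/=; lra.
- apply: derivable_within_continuous => x; rewrite in_itv/= => xst.
  by have [Qx _] := h x xst; exact: ex_derive.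
- rewrite -subr_ge0 QE; apply: mulr_ge0; last lra.
  by apply: (h c _).2; move: cst; rewrite in_itv.
Qed.

(** This is what monotonicity of the integral says of a primitive [F] of [f], for
    any [f]; it gives back [F' = f] where [f] is continuous. *)
Definition mean_bounded (F f : R -> R) := forall s t c d, s <= t ->
  (forall x, s < x <= t -> c <= f x <= d) ->
  c * (t - s) <= F t - F s <= d * (t - s).

Lemma mean_bounded_is_derive (F f : R -> R) (z : R) : mean_bounded F f ->
  {for z, continuous f} -> is_derive z (1 : R) F (f z).
Proof.
move=> Ff fz; apply/is_derive1_caratheodory.
pose g y := if y == z then f z else (F y - F z) / (y - z).
exists g; split=> [y||]; rewrite /g ?eqxx//.
  by have [->|yz] := eqVneq y z; rewrite ?subrr ?mulr0// divfK// subr_eq0.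
apply/cvgrPdist_le => e e0; rewrite eqxx.
move/cvgrPdist_le : fz => /(_ e e0)/nbhs_ballP[d /= d0 dz].
apply/nbhs_ballP; exists d => //= y yz.
have [_|yNz] := eqVneq y z; first by rewrite subrr normr0 ltW.
have fe x : Num.min y z <= x <= Num.max y z -> f z - e <= f x <= f z + e.
  move=> xyz; have := dz x; rewrite /ball/= ler_norml => h.
  suff : `|z - x| < d by move=> /h; lra.
  move: yz xyz; rewrite /ball/= !ltr_norml ge_min le_max.
  by case: (leP y z) => ? ? /andP[/orP[]? /orP[]?]; lra.
have [yz'|zy'] := ltP y z.
  have hz : 0 < z - y by lra.
  have {}fe x : y < x <= z -> f z - e <= f x <= f z + e.
    by move=> xyz; apply: fe; rewrite ge_min le_max; lra.
  have := Ff y z _ _ (ltW yz') fe.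
  rewrite -(ler_pdivlMr _ _ hz) -(ler_pdivrMr _ _ hz) -[_ / (y - z)]mulrNN -invrN !opprB.
  by rewrite ler_norml; lra.
have {}zy' : z < y by rewrite lt_neqAle eq_sym yNz.
have hz : 0 < y - z by lra.
have {}fe x : z < x <= y -> f z - e <= f x <= f z + e.
  by move=> xyz; apply: fe; rewrite ge_min le_max; lra.
have := Ff z y _ _ (ltW zy') fe.
by rewrite -(ler_pdivlMr _ _ hz) -(ler_pdivrMr _ _ hz) ler_norml; lra.
Qed.

End Derivatives.

Section LogConcave.
Context {R : realType}.
Variables (I : set R) (V f F : R -> R).
Hypothesis I_conv : forall x y z, I x -> I y -> x <= z -> z <= y -> I z.
Hypothesis I_open : forall z, I z -> exists e, [/\ 0 < e, I (z - e) & I (z + e)].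
Hypothesis V_conv : forall x y z, I x -> I y -> x <= z -> z <= y ->
  (y - x) * V z <= (y - z) * V x + (z - x) * V y.
Hypothesis fV : forall x, I x -> f x = expR (- V x).
Hypothesis Ff : mean_bounded F f.

(** The slope is the left derivative, the supremum of the slopes on the left. *)
Lemma convex_support z : I z -> exists k, forall t, I t -> V z + k * (t - z) <= V t.
Proof.
move=> Iz; have [e [e0 Izl Izr]] := I_open _ Iz.
pose S := [set (V z - V t) / (z - t) | t in [set t | I t /\ t < z]].
have Sub y : I y -> z < y -> ubound S ((V y - V z) / (y - z)).
  move=> Iy zy _ [t [It tz] <-].
  have := V_conv _ _ _ It Iy (ltW tz) (ltW zy).
  rewrite ler_pdivrMr ?subr_gt0// mulrAC ler_pdivlMr ?subr_gt0//; lra.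
have S0 : has_sup S.
  split; first by exists ((V z - V (z - e)) / (z - (z - e))), (z - e) => //; split=> //; lra.
  by exists ((V (z + e) - V z) / (z + e - z)); apply: Sub => //; lra.
exists (sup S) => t It; have [tz|] := ltP t z.
  have : (V z - V t) / (z - t) <= sup S.
    by apply: sup_upper_bound => //; exists t.
  by rewrite ler_pdivrMr ?subr_gt0//; lra.
rewrite le_eqVlt => /predU1P[->|zt]; first by rewrite subrr mulr0 addr0.
have : sup S <= (V t - V z) / (t - z).
  by apply: ge_sup; [case: S0|exact: Sub].
by rewrite ler_pdivlMr ?subr_gt0//; lra.
Qed.

Lemma convex_support_left z k s t : I s -> I z ->
  (forall t, I t -> V z + k * (t - z) <= V t) -> s <= t -> t <= z ->
  V t <= V s + k * (t - s).
Proof.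
move=> Is Iz Vk; rewrite le_eqVlt => /predU1P[->|st]; first by rewrite subrr mulr0 addr0.
rewrite le_eqVlt => /predU1P[->|tz]; first by have := Vk _ Is; lra.
have It : I t by apply: (I_conv _ _ _ Is Iz); exact: ltW.
have := V_conv _ _ _ Is Iz (ltW st) (ltW tz); have := Vk _ It.
have zt : 0 < z - t by lra.
move=> h1 h2; rewrite -(ler_pM2l zt).
suff : 0 <= (t - s) * (V t - V z - k * (t - z)) by lra.
by apply: mulr_ge0; lra.
Qed.

Lemma convex_support_right z k s t : I z -> I t ->
  (forall t, I t -> V z + k * (t - z) <= V t) -> z <= s -> s <= t ->
  V s + k * (t - s) <= V t.
Proof.
move=> Iz It Vk; rewrite le_eqVlt => /predU1P[zE|zs].
  by move=> _; rewrite -zE; exact: Vk.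
rewrite le_eqVlt => /predU1P[->|st]; first by rewrite subrr mulr0 addr0.
have Is : I s by apply: (I_conv _ _ _ Iz It); exact: ltW.
have := V_conv _ _ _ Iz It (ltW zs) (ltW st); have := Vk _ Is.
have sz : 0 < s - z by lra.
move=> h1 h2; rewrite -(ler_pM2l sz).
suff : 0 <= (t - s) * (V s - V z - k * (s - z)) by lra.
by apply: mulr_ge0; lra.
Qed.

Lemma convex_continuous z : I z -> {for z, continuous V}.
Proof.
move=> Iz; have [k Vk] := convex_support _ Iz; have [e [e0 Izl Izr]] := I_open _ Iz.
pose C := `|k| + `|V (z - e) - V z| / e + `|V (z + e) - V z| / e.
have C0 : 0 <= C by rewrite !addr_ge0// divr_ge0// ltW.
have lip t : `|z - t| < e -> `|V z - V t| <= C * `|z - t|.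
  move=> zt; have It : I t.
    by apply: (I_conv _ _ _ Izl Izr); move: zt; rewrite ltr_norml; lra.
  have kz : `|k * (t - z)| = `|k| * `|z - t| by rewrite normrM (distrC t).
have C1 : 0 <= `|V (z - e) - V z| / e * `|z - t| by rewrite mulr_ge0// divr_ge0// ltW.
have C2 : 0 <= `|V (z + e) - V z| / e * `|z - t| by rewrite mulr_ge0// divr_ge0// ltW.
have k0 : 0 <= `|k| * `|z - t| by rewrite mulr_ge0.
have := Vk _ It; have := ler_norm (- (k * (t - z))); rewrite normrN kz => h1 h2.
suff h : V t - V z <= `|V (z - e) - V z| / e * `|z - t| + `|V (z + e) - V z| / e * `|z - t|.
  by rewrite /C !mulrDl ler_norml; lra.
have [tz|zt'] := leP t z.
  suff : V t - V z <= `|V (z - e) - V z| / e * `|z - t| by lra.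
  move: zt; rewrite (ger0_norm (_ : 0 <= z - t)); last lra.
  move=> zt; have te : z - e <= t by lra.
  have := V_conv _ _ _ Izl Iz te tz => h3.
  rewrite mulrAC ler_pdivlMr//.
  have := ler_wpM2r (_ : 0 <= z - t) (ler_norm (V (z - e) - V z)); lra.
suff : V t - V z <= `|V (z + e) - V z| / e * `|z - t| by lra.
move: zt; rewrite (ler0_norm (_ : z - t <= 0)); last lra.
move=> zt; have te : t <= z + e by lra.
have := V_conv _ _ _ Iz Izr (ltW zt') te => h3.
rewrite mulrAC ler_pdivlMr//.
have := ler_wpM2r (_ : 0 <= t - z) (ler_norm (V (z + e) - V z)); lra.
apply/cvgrPdist_lt => d d0; near=> t.
have zt : `|z - t| < e by near: t; exact: cvgr_dist_lt.
apply: le_lt_trans (lip t zt) _.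
apply: (@le_lt_trans _ _ ((C + 1) * `|z - t|)); first by rewrite ler_wpM2r// lerDl.
rewrite -ltr_pdivlMl ?ltr_wpDl//.
by near: t; apply: cvgr_dist_lt => //; rewrite mulr_gt0// invr_gt0 ltr_wpDl.
Unshelve. all: by end_near.
Qed.

Lemma log_concave_continuous z : I z -> {for z, continuous f}.
Proof.
move=> Iz; have [e [e0 Izl Izr]] := I_open _ Iz.
have expVc : {for z, continuous (fun t => expR (- V t))}.
  by apply: continuous_comp; [exact: continuousN (convex_continuous _ Iz)|exact: continuous_expR].
suff : f x @[x --> z] --> expR (- V z) by rewrite -fV.
apply: cvg_trans expVc; apply: near_eq_cvg.
near=> t; rewrite fV//; apply: (I_conv _ _ _ Izl Izr).
  by near: t; apply: cvgr_ge; [exact: cvg_id|lra].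
by near: t; apply: cvgr_le; [exact: cvg_id|lra].
Unshelve. all: by end_near.
Qed.

Lemma log_concave_is_derive z : I z -> is_derive z (1 : R) F (f z).
Proof. by move=> Iz; apply: mean_bounded_is_derive => //; exact: log_concave_continuous. Qed.

(** For a supporting slope [k] of [V] at [z], the function [f + k * F] is maximal at
    [z]; this is clear from its derivative [(k - V') * f] when [V] is smooth.  In
    general, between [x] and [z], the increments of [k * F] are compared with those
    of the exponential [- expR (- V d - k * (u - d))], where [d] is [x] or [z], the
    choice depending on the sign of [k] and on the side of [x]: support at [z]
    then gives the sign of the derivative of the difference. *)
Lemma log_concave_supergradient z : I z ->
  exists k, forall x, I x -> f x <= f z + k * (F x - F z).
Proof.
move=> Iz; have [k Vk] := convex_support _ Iz; exists (- k) => x Ix.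
have [Ex Ez] : f x = expR (- V x) /\ f z = expR (- V z) by rewrite !fV.
have cmp K S d s t : s <= t -> I s -> I t ->
    (forall u, s <= u <= t -> 0 <= K * f u + S * (- k * expR (- V d - k * (u - d)))) ->
    K * F s + S * expR (- V d - k * (s - d)) <= K * F t + S * expR (- V d - k * (t - d)).
  move=> st Is It h.
  apply: (is_derive_nonneg_le (fun u => K * F u + S * expR (- V d - k * (u - d)))
    (fun u => K * f u + S * (- k * expR (- V d - k * (u - d)))) s t st) => u ust.
  have Iu : I u by apply: (I_conv _ _ _ Is It); lra.
  split; last exact: h.
  have Fu := log_concave_is_derive _ Iu.
  have Lu : is_derive u (1 : R) (fun u => - V d - k * (u - d)) (- k).
    by apply: is_derive_eq; rewrite /GRing.scale/=; lra.
  have Eu := @is_derive1_comp _ expR (fun u => - V d - k * (u - d)) u _ _ (is_derive_expR _) Lu.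
  have -> : K * f u + S * (- k * expR (- V d - k * (u - d))) =
     K *: f u + S *: (expR (- V d - k * (u - d)) * - k) by rewrite /GRing.scale/=; lra.
  exact: is_deriveD (is_deriveZ K Fu) (is_deriveZ S Eu).
have fle u w : I u -> w <= V u -> f u <= expR (- w).
  by move=> Iu wV; rewrite fV// ler_expR lerN2.
have fge u w : I u -> V u <= w -> expR (- w) <= f u.
  by move=> Iu wV; rewrite fV// ler_expR lerN2.
have e0 d : expR (- V d - k * (d - d)) = expR (- V d) by rewrite subrr mulr0 subr0.
have eN d u : - V d - k * (u - d) = - (V d + k * (u - d)) by rewrite opprD.
have [xz|/ltW zx] := leP x z; have [k0|/ltW k0] := leP 0 k.
- have := cmp k 1 x x z xz Ix Iz.
  have fx : expR (- V x - k * (z - x)) <= f z.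
    by rewrite eN; apply: fge => //; exact: (convex_support_left _ _ _ _ Ix Iz Vk).
  rewrite e0 -Ex !mul1r => h; apply: le_trans (_ : f x <= f z + k * (F z - F x)) _; last lra.
  suff : k * F x + f x <= k * F z + expR (- V x - k * (z - x)) by lra.
  apply: h => u uxz; rewrite mul1r mulNr -mulrBr mulr_ge0// subr_ge0 eN.
  apply: fge; first by apply: (I_conv _ _ _ Ix Iz); lra.
  by apply: (convex_support_left _ _ _ _ Ix Iz Vk); lra.
- have := cmp k 1 z x z xz Ix Iz.
  have fx : f x <= expR (- V z - k * (x - z)) by rewrite eN; apply: fle => //; exact: Vk.
  rewrite e0 -Ez !mul1r => h.
  suff : k * F x + expR (- V z - k * (x - z)) <= k * F z + f z by lra.
  apply: h => u uxz; rewrite mul1r mulNr -mulrBr mulr_le0// subr_le0 eN.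
  have Iu : I u by apply: (I_conv _ _ _ Ix Iz); lra.
  by apply: fle => //; exact: Vk.
- have := cmp (- k) (- 1) z z x zx Iz Ix.
  have fx : f x <= expR (- V z - k * (x - z)) by rewrite eN; apply: fle => //; exact: Vk.
  rewrite e0 -Ez !mulN1r => h.
  suff : - k * F z - f z <= - k * F x - expR (- V z - k * (x - z)) by lra.
  apply: h => u uxz; suff : 0 <= k * (expR (- V z - k * (u - z)) - f u) by lra.
  rewrite mulr_ge0// subr_ge0 eN.
  have Iu : I u by apply: (I_conv _ _ _ Iz Ix); lra.
  by apply: fle => //; exact: Vk.
- have := cmp (- k) (- 1) x z x zx Iz Ix.
  have fx : expR (- V x - k * (z - x)) <= f z.
    rewrite eN; apply: fge => //.
    have := convex_support_right _ _ z x Iz Ix Vk (lexx z) zx; lra.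
  rewrite e0 -Ex !mulN1r => h.
  suff : - k * F z - expR (- V x - k * (z - x)) <= - k * F x - f x by lra.
  apply: h => u uxz; suff : 0 <= k * (expR (- V x - k * (u - x)) - f u) by lra.
  rewrite mulr_le0// subr_le0 eN.
  have Iu : I u by apply: (I_conv _ _ _ Iz Ix); lra.
  apply: fge => //; have : V u + k * (x - u) <= V x.
    by apply: (convex_support_right _ _ _ _ Iz Ix Vk); lra.
  lra.
Qed.

End LogConcave.

(** * The cumulative distribution function and its inverse *)

Section OpenInterval.
Context {R : realType} (a b : \bar R).
Local Notation I := (open_interval a b).

Lemma open_interval_conv x y z : I x -> I y -> x <= z -> z <= y -> I z.
Proof.
move=> [ax xb] [ay yb] xz zy; split.
  by apply: lt_le_trans ax _; rewrite lee_fin.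
by apply: le_lt_trans yb; rewrite lee_fin.
Qed.

Lemma open_interval_open z : I z -> exists e, [/\ 0 < e, I (z - e) & I (z + e)].
Proof.
case=> az zb.
have [d [d0 ad]] : exists d : R, 0 < d /\ (a < (z - d)%:E)%E.
  move: az; case: a => [r|//|_].
    by rewrite lte_fin => rz; exists ((z - r) / 2); rewrite lte_fin; lra.
  by exists 1; split=> //; exact: ltNyr.
have [e [e0 eb]] : exists e : R, 0 < e /\ ((z + e)%:E < b)%E.
  move: zb; case: b => [r|_|//].
    by rewrite lte_fin => rz; exists ((r - z) / 2); rewrite lte_fin; lra.
  by exists 1; split=> //; exact: ltry.
exists (Num.min d e); split; first by rewrite lt_min d0.
  split; first by apply: lt_le_trans ad _; rewrite lee_fin lerD2l lerN2 ge_min lexx.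
  apply: le_lt_trans zb; rewrite lee_fin gerBl le_min; lra.
split; first by apply: lt_le_trans az _; rewrite lee_fin lerDl le_min; lra.
by apply: le_lt_trans eb; rewrite lee_fin lerD2l ge_min lexx orbT.
Qed.

Lemma convex_function_chord (V : R -> R) : convex_function I V ->
  forall x y z, I x -> I y -> x <= z -> z <= y ->
  (y - x) * V z <= (y - z) * V x + (z - x) * V y.
Proof.
move=> Vc x y z Ix Iy xz zy.
have [xy|xy] := ltP x y; last first.
  have [-> ->] : z = x /\ y = x by split; lra.
  by rewrite !subrr !mul0r addr0.
have yx0 : 0 < y - x by rewrite subr_gt0.
have t0 : 0 <= (y - z) / (y - x) by rewrite divr_ge0 ?subr_ge0// ltW.
have t1 : (y - z) / (y - x) <= 1 by rewrite ler_pdivrMr// mul1r lerD2l lerN2.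
have t01 : Itv.spec (@Itv.num_sem R) (Itv.Real `[0%Z, 1%Z]) ((y - z) / (y - x)).
  by rewrite /= /Itv.num_sem ger0_real//= in_itv/= t0.
pose t := (y - z) / (y - x).
have h : V (t * x + (1 - t) * y) <= t * V x + (1 - t) * V y.
  by apply: (Vc (Itv.mk t01)); rewrite inE.
have tE : t * (y - x) = y - z by rewrite /t divfK// gt_eqF.
have zE : t * x + (1 - t) * y = z by lra.
have := ler_wpM2l (ltW yx0) h; rewrite zE; congr (_ <= _).
transitivity (t * (y - x) * V x + (y - x - t * (y - x)) * V y); first ring.
by rewrite tE; ring.
Qed.

End OpenInterval.

Lemma finite_set_isolated {R : realType} (A : set R) (t : R) : finite_set A ->
  exists2 d, 0 < d & forall u, A u -> `|u - t| < d -> u = t.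
Proof.
move=> /finite_seqP[s ->]; elim: s => [|x s [d d0 hd]]; first by exists 1.
have [->|xt] := eqVneq x t.
  by exists d => // u; rewrite /= inE => /orP[/eqP->//|]; exact: hd.
exists (Num.min d `|x - t|); first by rewrite lt_min d0 normr_gt0 subr_eq0.
move=> u; rewrite /= inE lt_min => /orP[/eqP->|us] /andP[ud ux]; last exact: hd.
by rewrite ltxx in ux.
Qed.

Section SymmetricLogConcaveMeasure.
Context {R : realType}.
Local Notation leb := (@completed_lebesgue_measure R).
Variables (mu : probability (lebesgueType R) R) (f : R -> R) (a b : \bar R).
Hypothesis f_density : has_density mu f.
Hypothesis f_pos : forall x : R, open_interval a b x -> 0 < f x.
Hypothesis f_zero : forall x : R, ~ open_interval a b x -> f x = 0.
Hypothesis f_log_concave : log_concave_on a b f.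
Hypothesis f_symmetric : forall x : R, f (- x) = f x.
Local Notation I := (open_interval a b).
Local Notation F := (cumul mu).
Local Notation q := (quantile mu a b).
Implicit Types A B O : set (lebesgueType R).

Lemma f_ge0 x : 0 <= f x.
Proof. by case: f_density. Qed.

Lemma mass_ge0 A : 0 <= mass mu A.
Proof. exact: fine_ge0. Qed.

Lemma mass_fineK A : measurable A -> (mass mu A)%:E = mu A.
Proof. by move=> mA; rewrite /mass fineK// fin_num_measure. Qed.

Lemma mass_setT : mass mu setT = 1.
Proof. by rewrite /mass probability_setT. Qed.

Lemma le_mass A B : measurable A -> measurable B -> A `<=` B -> mass mu A <= mass mu B.
Proof.
move=> mA mB; apply: le_fine_measure => //.
by rewrite -ge0_fin_numE// fin_num_measure.
Qed.

Lemma mass_le1 A : measurable A -> mass mu A <= 1.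
Proof. by move=> mA; rewrite -mass_setT le_mass. Qed.

Lemma mass_setU A B : measurable A -> measurable B -> A `&` B = set0 ->
  mass mu (A `|` B) = mass mu A + mass mu B.
Proof.
by move=> mA mB; apply: fine_measureU => //; rewrite -ge0_fin_numE// fin_num_measure.
Qed.

Lemma mass_setID A B : measurable A -> measurable B ->
  mass mu A = mass mu (A `&` B) + mass mu (A `\` B).
Proof.
move=> mA mB; rewrite -[in LHS](setUIDK A B) mass_setU//.
- exact: measurableI.
- exact: measurableD.
- by rewrite setDE; apply/seteqP; split=> // x [[_ ?] [_]].
Qed.

Lemma mass_setC A : measurable A -> mass mu (~` A) = 1 - mass mu A.
Proof.
move=> mA; have := mass_setID setT A measurableT mA.
by rewrite setTI setTD mass_setT; lra.
Qed.

Lemma measurable_f_bar A : measurable_fun A (EFin \o (f : lebesgueType R -> R)).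
Proof.
case: f_density => mf _ _; apply/measurable_EFinP.
by apply: measurable_funS mf.
Qed.

Lemma mass_null A : measurable A -> leb A = 0%E -> mass mu A = 0.
Proof.
move=> mA A0; have [_ _ fE] := f_density.
rewrite /mass fE// null_set_integral//; exact: measurable_f_bar.
Qed.

Lemma mass_vanish A : measurable A -> (forall x, A x -> f x = 0) -> mass mu A = 0.
Proof.
move=> mA A0; have [_ _ fE] := f_density.
by rewrite /mass fE// integral0_eq// => x Ax; rewrite A0.
Qed.

Lemma mass_set1 (x : R) : mass mu [set x] = 0.
Proof.
apply: mass_null; last exact: lebesgue_set1.
by apply: sub_caratheodory; exact: measurable_set1.
Qed.

Lemma cumulB s t : s <= t -> F t - F s = mass mu `]s, t].
Proof.
move=> st; rewrite /cumul (itv_bndbnd_setU (_ : _ <= BRight s)%O (_ : _ <= BRight t)%O)//.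
rewrite mass_setU; [lra|exact: measurable_lebesgue_itv|exact: measurable_lebesgue_itv|].
by apply/seteqP; split=> // x [/=]; rewrite !in_itv/=; lra.
Qed.

Lemma cumul_mean_bounded : mean_bounded F f.
Proof.
move=> s t c d st cd; rewrite cumulB//.
have mst : measurable (`]s, t]%classic : set (lebesgueType R)) by exact: measurable_lebesgue_itv.
have [_ _ fE] := f_density.
have ts0 : 0 <= t - s by rewrite subr_ge0.
have cstE r : (\int[leb]_(x in `]s, t]) r%:E)%E = (r * (t - s))%:E.
  by transitivity (r%:E * leb `]s, t])%E; [exact: integral_cst|rewrite lebesgue_itv].
have [|st'] := eqVneq s t.
  by move=> <-; rewrite subrr !mulr0 set_itv_ge ?bnd_simp ?ltxx// /mass measure0 lexx.
have {}st : s < t by rewrite lt_neqAle st'.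
have d0 : 0 <= d.
  have := cd t; rewrite st lexx => /(_ isT); have := f_ge0 t; lra.
apply/andP; split.
  apply: (@le_trans _ _ (Num.max c 0 * (t - s))).
    by rewrite ler_wpM2r// le_max lexx.
  rewrite -lee_fin mass_fineK// fE// -cstE; apply: ge0_le_integral => //.
  - by move=> x _; rewrite lee_fin le_max lexx orbT.
  - exact: measurable_f_bar.
  - move=> x; rewrite /= in_itv/= => /cd /andP[cf _].
    by rewrite lee_fin ge_max cf f_ge0.
rewrite -lee_fin mass_fineK// fE// -cstE; apply: ge0_le_integral => //.
- by move=> x _; rewrite lee_fin f_ge0.
- exact: measurable_f_bar.
- by move=> x; rewrite /= in_itv/= => /cd /andP[_ fd]; rewrite lee_fin.
Qed.

Lemma interval_opp x : I x -> I (- x).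
Proof.
move=> Ix; apply: contrapT => /f_zero fx0.
by have := f_pos _ Ix; rewrite -f_symmetric fx0 ltxx.
Qed.

Lemma interval0 : I 0.
Proof.
have [x Ix] : exists x, I x.
  apply: contrapT => /forallNP I0.
  have : mass mu setT = 0 by apply: mass_vanish => // x _; exact: f_zero.
  by rewrite mass_setT => /eqP; rewrite oner_eq0.
have [x0|/ltW x0] := leP 0 x.
  by apply: (open_interval_conv a b _ _ _ (interval_opp _ Ix) Ix) => //; rewrite oppr_le0.
by apply: (open_interval_conv a b _ _ _ Ix (interval_opp _ Ix)) => //; rewrite oppr_ge0.
Qed.

(** A convex [V] is at most the maximum of its values at the ends. *)
Lemma f_unimodal s t z : I s -> I t -> s <= z -> z <= t -> Num.min (f s) (f t) <= f z.
Proof.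
case: f_log_concave => V Vc fV Is It sz zt.
have Iz := open_interval_conv _ _ _ _ _ Is It sz zt.
have h := convex_function_chord _ _ _ Vc _ _ _ Is It sz zt.
rewrite !fV// ge_min !ler_expR !lerN2.
have [Vst|Vts] := leP (V s) (V t); apply/orP; [right|left].
  have [ts|st] := leP t s; first by have <- : z = t by lra.
  have ts0 : 0 < t - s by rewrite subr_gt0.
  rewrite -(ler_pM2l ts0); have := ler_wpM2l (_ : 0 <= t - z) Vst; lra.
have [ts|st] := leP t s; first by have <- : z = s by lra.
have ts0 : 0 < t - s by rewrite subr_gt0.
rewrite -(ler_pM2l ts0); have := ler_wpM2l (_ : 0 <= z - s) (ltW Vts); lra.
Qed.

Lemma f_le_f0 x : f x <= f 0.
Proof.
have [Ix|/f_zero ->] := pselect (I x); last exact: f_ge0.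
have Inx := interval_opp _ Ix.
have [x0|/ltW x0] := leP 0 x.
  by apply: le_trans (f_unimodal _ _ 0 Inx Ix _ _); rewrite ?f_symmetric ?minxx ?oppr_le0.
by apply: le_trans (f_unimodal _ _ 0 Ix Inx _ _); rewrite ?f_symmetric ?minxx ?oppr_ge0.
Qed.

Lemma cumul_lipschitz s t : s <= t -> 0 <= F t - F s <= f 0 * (t - s).
Proof.
move=> st; have := cumul_mean_bounded s t 0 (f 0) st; rewrite mul0r; apply=> x _.
by rewrite f_ge0 f_le_f0.
Qed.

Lemma le_cumul s t : s <= t -> F s <= F t.
Proof. by move=> /cumul_lipschitz; lra. Qed.

Lemma cumul_bounds x : 0 <= F x <= 1.
Proof. by rewrite mass_ge0 mass_le1//; exact: measurable_lebesgue_itv. Qed.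

Lemma cumul_continuous x : {for x, continuous F}.
Proof.
apply/cvgrPdist_lt => e e0.
have f0 := f_pos _ interval0.
have d0 : 0 < (f 0)^-1 * e by rewrite mulr_gt0// invr_gt0.
near=> y.
apply: (@le_lt_trans _ _ (f 0 * `|x - y|)).
  have [xy|/ltW yx] := leP x y.
    rewrite ler0_norm; last by have := cumul_lipschitz _ _ xy; lra.
    rewrite ler0_norm ?subr_le0//; have := cumul_lipschitz _ _ xy; lra.
  rewrite ger0_norm; last by have := cumul_lipschitz _ _ yx; lra.
  by rewrite ger0_norm ?subr_ge0//; have := cumul_lipschitz _ _ yx; lra.
rewrite -ltr_pdivlMl//.
Unshelve. all: by end_near.
Qed.

Lemma cumul_outside x : ~ I x -> F x = 0 \/ F x = 1.
Proof.
move=> NIx; have [ax|xa] := boolP (a < x%:E)%E; last first.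
  left; apply: mass_vanish; first exact: measurable_lebesgue_itv.
  move=> y /=; rewrite in_itv/= => yx; apply: f_zero => -[ay _].
  by move/negP: xa; apply; apply: lt_le_trans ay _; rewrite lee_fin.
right; have := mass_setC _ (measurable_lebesgue_itv `]-oo, x]); rewrite setCitvl.
suff -> : mass mu `]x, +oo[ = 0 by rewrite /cumul; lra.
apply: mass_vanish; first exact: measurable_lebesgue_itv.
move=> y /=; rewrite in_itv/= andbT => xy; apply: f_zero => -[_ yb]; apply: NIx.
by split=> //; apply: lt_trans yb; rewrite lte_fin.
Qed.

Lemma cumul_lt s t : I s -> I t -> s < t -> F s < F t.
Proof.
move=> Is It st.
have := cumul_mean_bounded s t (Num.min (f s) (f t)) (f 0) (ltW st).
have m0 : 0 < Num.min (f s) (f t) * (t - s).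
  by rewrite mulr_gt0 ?subr_gt0// lt_min !f_pos.
suff h x : s < x <= t -> Num.min (f s) (f t) <= f x <= f 0 by move=> /(_ h); lra.
by case/andP=> sx xt; rewrite f_le_f0 f_unimodal// ltW.
Qed.

Lemma mass_exhaust (A : (set (lebesgueType R))^nat) e : (forall n, measurable (A n)) ->
  nondecreasing_seq A -> \bigcup_n A n = setT -> 0 < e -> exists n, 1 - e < mass mu (A n).
Proof.
move=> mA ndA AT e0.
have muA : mu (A n) @[n --> \oo] --> (1%:E : \bar R).
  rewrite (_ : 1%:E = mu setT); last by rewrite probability_setT.
  by rewrite -AT; apply: nondecreasing_cvg_mu => //; rewrite AT.
move: muA => /fine_cvg /cvgrPdist_lt /(_ e e0) [n _ /(_ n (leqnn n))] /=.
by rewrite ltr_norml => /andP[_ h]; exists n; rewrite /mass; lra.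
Qed.

Lemma cumul_lim1 e : 0 < e -> exists x, 1 - e < F x.
Proof.
move=> e0.
have [n|m n mn||n hn] := mass_exhaust (fun n => `]-oo, n%:R]%classic) e _ _ _ e0.
- exact: measurable_lebesgue_itv.
- apply/subsetPset => x /=; rewrite !in_itv/= => /le_trans; apply.
  by rewrite ler_nat.
- rewrite -subTset => x _; exists (Num.truncn `|x|).+1 => //=; rewrite in_itv/=.
  by apply: le_trans (ler_norm x) _; apply: ltW; exact: truncnS_gt.
- by exists n%:R.
Qed.

Lemma cumul_lim0 e : 0 < e -> exists x, F x < e.
Proof.
move=> e0.
have [n|m n mn||n hn] := mass_exhaust (fun n => `]- n%:R, +oo[%classic) e _ _ _ e0.
- exact: measurable_lebesgue_itv.
- apply/subsetPset => x /=; rewrite !in_itv/= !andbT; apply: le_lt_trans.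
  by rewrite lerN2 ler_nat.
- rewrite -subTset => x _; exists (Num.truncn `|x|).+1 => //=; rewrite in_itv/= andbT.
  rewrite ltrNl; apply: le_lt_trans (ler_norm (- x)) _; rewrite normrN; exact: truncnS_gt.
- exists (- n%:R); have := mass_setC _ (measurable_lebesgue_itv `]-oo, (- n%:R : R)]).
  by rewrite setCitvl /cumul; lra.
Qed.

Lemma cumul_surj r : 0 < r < 1 -> exists2 x, I x & F x = r.
Proof.
move=> r01; have [|x xr] := cumul_lim0 r; first by case/andP: r01.
have [|y yr] := cumul_lim1 (1 - r); first by lra.
have xy : x <= y by rewrite leNgt; apply/negP => /ltW /le_cumul; lra.
have [||z zxy Fz] := @IVT _ F x y r xy.
- by apply: continuous_subspaceT; exact: cumul_continuous.
- by rewrite ge_min le_max; lra.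
exists z => //; apply: contrapT => /cumul_outside; lra.
Qed.

Lemma cumul_inj : {in I &, injective F}.
Proof.
move=> x y; rewrite !inE => Ix Iy Fxy; apply/eqP; rewrite eq_le !leNgt.
apply/andP; split; apply/negP => xy.
  by have := cumul_lt _ _ Iy Ix xy; rewrite Fxy ltxx.
by have := cumul_lt _ _ Ix Iy xy; rewrite Fxy ltxx.
Qed.

Lemma quantileK x : I x -> q (F x) = x.
Proof. by move=> Ix; apply: pinvKV; [exact: cumul_inj|rewrite inE]. Qed.

Lemma quantile_in r : 0 < r < 1 -> I (q r) /\ F (q r) = r.
Proof. by move=> /cumul_surj[x Ix <-]; rewrite quantileK. Qed.

Lemma cumul_interior x : I x -> 0 < F x < 1.
Proof.
move=> Ix; have [e [e0 Il Ir]] := open_interval_open a b _ Ix.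
have := cumul_lt _ _ Il Ix; have := cumul_lt _ _ Ix Ir.
have := cumul_bounds (x - e); have := cumul_bounds (x + e); lra.
Qed.

Lemma quantile_lt r s : 0 < r < 1 -> 0 < s < 1 -> r < s -> q r < q s.
Proof.
move=> r01 s01 rs; rewrite ltNge; apply/negP => /le_cumul.
by rewrite (quantile_in _ r01).2 (quantile_in _ s01).2; lra.
Qed.

Lemma log_concave_chord : exists V : R -> R,
  (forall x y z, I x -> I y -> x <= z -> z <= y ->
    (y - x) * V z <= (y - z) * V x + (z - x) * V y) /\
  (forall x, I x -> f x = expR (- V x)).
Proof.
case: f_log_concave => V Vc fV; exists V; split=> //.
by move=> x y z; exact: convex_function_chord.
Qed.

Lemma cumul_is_derive x : I x -> is_derive x (1 : R) F (f x).
Proof.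
have [V [Vc fV]] := log_concave_chord.
by apply: (log_concave_is_derive I V) => //;
  [exact: open_interval_conv|exact: open_interval_open|exact: cumul_mean_bounded].
Qed.

(** The derivative of [F x + F (- x)] is [f x - f (- x) = 0], and the
    constant is 1 because [F] tends to 0 and 1 at the ends of the interval. *)
Lemma cumul_opp x : I x -> F (- x) = 1 - F x.
Proof.
move=> Ix.
have K_cst s t : I s -> I t -> F s + F (- s) = F t + F (- t).
  wlog st : s t / s <= t => [hw Is It|Is It].
    by have [/hw|/ltW/hw h] := leP s t; [exact|rewrite h].
  have KD K u : s <= u <= t -> is_derive u (1 : R) (fun u => K *: (F u + F (- u))) 0.
    move=> ust; have Iu : I u by apply: (open_interval_conv a b _ _ _ Is It); lra.
    have Fu := cumul_is_derive _ Iu.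
    have Fn := cumul_is_derive _ (interval_opp _ Iu).
    have Nu : is_derive u (1 : R) (fun u : R => - u) (- 1) by exact: is_deriveN.
    have FN := @is_derive1_comp _ F (fun u => - u) u _ _ Fn Nu.
    have -> : 0 = K *: (f u + f (- u) * -1) by rewrite f_symmetric mulrN1 subrr scaler0.
    exact: is_deriveZ (is_deriveD Fu FN).
  have h K := is_derive_nonneg_le (fun u => K *: (F u + F (- u))) (fun=> 0) s t st
    (fun u ust => conj (KD K u ust) (lexx 0)).
  have := h 1; have := h (-1); rewrite !scale1r !scaleN1r; lra.
have Ke e : 0 < e -> `|F x + F (- x) - 1| <= e.
  move=> e0.
  pose d := Num.min e 2^-1 / 2.
  have d0 : 0 < d by rewrite divr_gt0// lt_min e0; lra.
  have de : d * 2 <= e /\ d * 2 <= 2^-1 by rewrite /d divfK// !ge_min !lexx orbT.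
  have [|y Iy yF] := cumul_surj (1 - d); first lra.
  have [|z Iz zF] := cumul_surj d; first lra.
  have Inz := interval_opp _ Iz.
  have := K_cst _ _ Ix Iy; have := K_cst _ _ Ix Iz.
  have [yz|/ltW zy] := leP y (- z).
    have := le_cumul _ _ yz.
    have yz' : z <= - y by lra.
    have := le_cumul _ _ yz'; have := cumul_bounds (- z); have := cumul_bounds (- y).
    by rewrite ler_norml; lra.
  have := le_cumul _ _ zy.
  have yz' : - y <= z by lra.
  have := le_cumul _ _ yz'; have := cumul_bounds (- z); have := cumul_bounds (- y).
  by rewrite ler_norml; lra.
suff /eqP : F x + F (- x) - 1 = 0 by lra.
apply/eqP; rewrite -normr_le0; apply/ler_addgt0Pr => e e0; rewrite add0r; exact: Ke.
Qed.

Lemma quantile_opp r : 0 < r < 1 -> q (1 - r) = - q r.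
Proof.
move=> r01; have [Iq Fq] := quantile_in _ r01.
by rewrite -{1}Fq -cumul_opp// quantileK//; exact: interval_opp.
Qed.

(** * The isoperimetric profile *)

Local Notation J := (iso_profile mu f a b).

Lemma iso_profileE r : 0 < r < 1 -> J r = f (q r).
Proof. by rewrite /iso_profile => ->. Qed.

Lemma iso_profile_gt0 r : 0 < r < 1 -> 0 < J r.
Proof. by move=> r01; rewrite iso_profileE// f_pos//; case: (quantile_in _ r01). Qed.

Lemma iso_profile0 : J 0 = 0.
Proof. by rewrite /iso_profile ltxx. Qed.

Lemma iso_profile1 : J 1 = 0.
Proof. by rewrite /iso_profile ltxx andbF. Qed.

(** [J (F x) = f x], so this is [log_concave_supergradient] inside (0, 1).  An
    affine function that bounds [J] on (0, 1) is nonnegative at 0 and 1, where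
    [J] vanishes. *)
Lemma iso_profile_supergradient p : 0 < p < 1 ->
  exists k, forall r, 0 <= r <= 1 -> J r <= J p + k * (r - p).
Proof.
move=> p01; have [Ip Fp] := quantile_in _ p01.
have [V [Vc fV]] := log_concave_chord.
have [k hk] := log_concave_supergradient I V f F (open_interval_conv a b)
  (open_interval_open a b) Vc fV cumul_mean_bounded _ Ip.
have h r : 0 < r < 1 -> J r <= J p + k * (r - p).
  move=> r01; have [Ir Fr] := quantile_in _ r01.
  by rewrite !iso_profileE//; have := hk _ Ir; rewrite Fp Fr.
have affine0 (A B : R) : (forall r, 0 < r < 1 -> 0 <= A + B * r) -> 0 <= A.
  move=> AB; rewrite leNgt; apply/negP => A0.
  pose r := Num.min 2^-1 (- A / (2 * (`|B| + 1))).
  have B1 : 0 < `|B| + 1 by rewrite ltr_wpDl.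
  have B2 : 0 < 2 * (`|B| + 1) by rewrite mulr_gt0.
  have r0 : 0 < r by rewrite lt_min divr_gt0 ?oppr_gt0// andbT; lra.
  have r2 : r <= 2^-1 by rewrite ge_min lexx.
  have rA : r * (2 * (`|B| + 1)) <= - A.
    by rewrite -ler_pdivlMr// ge_min lexx orbT.
  have := AB r; have := ler_norm B; have := ler_wpM2r (ltW r0) (ler_norm B); lra.
exists k => r /andP[]; rewrite le_eqVlt => /predU1P[<- _|r0].
  rewrite iso_profile0.
  suff : 0 <= J p - k * p by lra.
  apply: (affine0 _ k) => s s01; have := h s s01; have := iso_profile_gt0 _ s01; lra.
rewrite le_eqVlt => /predU1P[->|r1]; last by apply: h; rewrite r0.
rewrite iso_profile1.
suff : 0 <= J p + k * (1 - p) by lra.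
apply: (affine0 _ (- k)) => s s01.
have s01' : 0 < 1 - s < 1 by lra.
have := h _ s01'; have := iso_profile_gt0 _ s01'; lra.
Qed.

Lemma iso_profile_concave_symmetric : concave_symmetric J.
Proof.
have J0 r : 0 <= J r by rewrite /iso_profile; case: ifP => // _; exact: f_ge0.
have Jout r : ~~ (0 < r < 1) -> J r = 0 by rewrite /iso_profile => /negbTE ->.
split=> [//|r r01|x y t x01 y01 t01].
  have [r01'|r01'] := boolP (0 < r < 1); last by rewrite !Jout//; lra.
  have r01'' : 0 < 1 - r < 1 by lra.
  by rewrite !iso_profileE// quantile_opp// f_symmetric.
have tx : 0 <= t * x by apply: mulr_ge0; lra.
have ty : 0 <= (1 - t) * y by apply: mulr_ge0; lra.
have tx' : 0 <= t * (1 - x) by apply: mulr_ge0; lra.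
have ty' : 0 <= (1 - t) * (1 - y) by apply: mulr_ge0; lra.
have [p01|p01] := boolP (0 < t * x + (1 - t) * y < 1).
  have [k hk] := iso_profile_supergradient _ p01.
  have t0 : 0 <= t by lra.
  have t1 : 0 <= 1 - t by lra.
  have := ler_wpM2l t0 (hk x x01); have := ler_wpM2l t1 (hk y y01); lra.
rewrite (Jout _ p01).
have endpoint c z : 0 <= c -> 0 <= z <= 1 -> c * z = 0 \/ c * (1 - z) = 0 -> c * J z = 0.
  move=> c0 z01; case=> /eqP; rewrite mulf_eq0 => /orP[/eqP ->|/eqP zE];
    rewrite ?mul0r// Jout ?mulr0//; lra.
rewrite (endpoint t x) ?(endpoint (1 - t) y) ?addr0//; lra.
Qed.

(** * The lower bound for a measurable set *)

Section Distribution.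
Variable O : set (lebesgueType R).
Hypothesis mO : measurable O.

(** The values at 0 and 1 are set by hand, [q] being the inverse of [F] on (0, 1)
    only. *)
Definition profile_mass (t : R) : R :=
  if t <= 0 then 0 else if 1 <= t then mass mu O else mass mu (O `&` `]-oo, q t]).

Definition profile_boundary : set R :=
  [set t | 0 < t < 1 /\ essential_boundary O (q t)].

Lemma measurable_setI_itv (i : interval R) : measurable (O `&` [set` i]).
Proof. exact: measurable_portion. Qed.

Lemma profile_massE t : 0 < t < 1 -> profile_mass t = mass mu (O `&` `]-oo, q t]).
Proof. by move=> /andP[t0 t1]; rewrite /profile_mass !leNgt t0 t1. Qed.

Lemma profile_mass0 : profile_mass 0 = 0.
Proof. by rewrite /profile_mass lexx. Qed.

Lemma profile_mass1 : profile_mass 1 = mass mu O.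
Proof. by rewrite /profile_mass lexx ler10. Qed.

Lemma le_mass_portion (i : interval R) :
  0 <= mass mu (O `&` [set` i]) <= mass mu [set` i].
Proof.
rewrite mass_ge0 le_mass//; first exact: measurable_setI_itv.
exact: measurable_lebesgue_itv.
Qed.

Lemma mass_portionD s t : s <= t -> mass mu (O `&` `]-oo, t]) =
  mass mu (O `&` `]-oo, s]) + mass mu (O `&` `]s, t]).
Proof.
move=> st; rewrite (itv_bndbnd_setU (_ : _ <= BRight s)%O (_ : _ <= BRight t)%O)//.
rewrite setIUr mass_setU//; try exact: measurable_setI_itv.
by apply/seteqP; split=> // x [[_ /=]]; rewrite in_itv/= => h [_ /=]; rewrite in_itv/=; lra.
Qed.

Lemma mass_portion_tail t : mass mu O =
  mass mu (O `&` `]-oo, t]) + mass mu (O `&` `]t, +oo[).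
Proof.
rewrite [LHS](mass_setID _ `]-oo, t])//; last exact: measurable_lebesgue_itv.
by rewrite setDE setCitvl.
Qed.

Lemma profile_massB r s : 0 < r -> r <= s -> s < 1 ->
  profile_mass s - profile_mass r = mass mu (O `&` `]q r, q s]).
Proof.
move=> r0 rs s1; rewrite !profile_massE; try lra.
rewrite (mass_portionD (q r) (q s)); first lra.
have [->//|rNs] := eqVneq r s.
by apply/ltW/quantile_lt; rewrite ?lt_neqAle ?rNs; lra.
Qed.

Lemma profile_mass_lipschitz r s : 0 <= r -> r <= s -> s <= 1 ->
  0 <= profile_mass s - profile_mass r <= s - r.
Proof.
have tail t : 0 < t < 1 -> mass mu `]q t, +oo[ = 1 - t.
  move=> t01; rewrite -setCitvl mass_setC; last exact: measurable_lebesgue_itv.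
  by have [_] := quantile_in _ t01; rewrite /cumul => ->.
have head t : 0 < t < 1 -> mass mu `]-oo, q t] = t.
  by move=> t01; have [_] := quantile_in _ t01.
rewrite le_eqVlt => /predU1P[<- s0|r0 rs].
  rewrite profile_mass0 !subr0 le_eqVlt => /predU1P[->|s1].
    by rewrite profile_mass1 mass_ge0 mass_le1.
  move: s0; rewrite le_eqVlt => /predU1P[<-|s0]; first by rewrite profile_mass0 lexx.
  have s01 : 0 < s < 1 by rewrite s0.
  by rewrite profile_massE//; have := le_mass_portion `]-oo, q s]; rewrite head.
rewrite le_eqVlt => /predU1P[sE|s1]; last first.
  rewrite profile_massB//; have := le_mass_portion `]q r, q s].
  have [rE|rNs] := eqVneq r s.
    by rewrite rE set_itv_ge ?bnd_simp ?ltxx// setI0 /mass measure0/=; lra.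
  have r01 : 0 < r < 1 by lra.
  have s01 : 0 < s < 1 by lra.
  rewrite -(cumulB (q r) (q s)); last first.
    by apply/ltW/quantile_lt => //; rewrite lt_neqAle rNs.
  by rewrite (quantile_in _ r01).2 (quantile_in _ s01).2.
subst s; move: rs; rewrite le_eqVlt => /predU1P[->|r1]; first by rewrite !subrr lexx.
have r01 : 0 < r < 1 by rewrite r0.
rewrite profile_mass1 profile_massE// [mass mu O](mass_portion_tail (q r)).
by have := le_mass_portion `]q r, +oo[; rewrite tail//; lra.
Qed.

(** [mu] is absolutely continuous: what is negligible for Lebesgue measure has no
    mass. *)
Lemma mass_portion_mixed u v : u < v -> 0 < mass mu (O `&` `]u, v]) < F v - F u ->
  0 < leb_portion O u v < v - u.
Proof.
move=> uv muv.
have mO' : measurable (O `&` `]u, v]) by exact: measurable_setI_itv.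
have mI : measurable (`]u, v]%classic : set (lebesgueType R)) by exact: measurable_lebesgue_itv.
have mD : measurable ((`]u, v]%classic : set (lebesgueType R)) `\` O) by exact: measurableD.
have null A : measurable A -> A `<=` `]u, v] -> fine (leb A) = 0 -> mass mu A = 0.
  move=> mA Auv A0; apply: mass_null => //.
  rewrite -[LHS]fineK ?A0// ge0_fin_numE//.
  apply: le_lt_trans (lebesgue_itv_lty u v false false).
  by apply: le_measure; rewrite ?inE//; exact: measurable_lebesgue_itv.
have lb := leb_portion_bounds O mO u v (ltW uv).
apply/andP; split; rewrite lt_neqAle; apply/andP; split; try by case/andP: lb.
  apply/eqP => /esym/null; rewrite /leb_portion => h.
  by have := h mO' (@subIsetr _ _ _); lra.
apply/eqP => lE.
have h1 : fine (leb `]u, v]) = fine (leb (O `&` `]u, v])) + fine (leb (`]u, v] `\` O)).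
  rewrite -fine_measureU//.
  - by congr (fine (leb _)); rewrite setIC setUIDK.
  - exact: portion_lty.
  - apply: le_lt_trans (lebesgue_itv_lty u v false false).
    by apply: le_measure; rewrite ?inE.
  - by rewrite setDE; apply/seteqP; split=> // x [[? _] [_]].
have h2 : fine (leb `]u, v]) = v - u by rewrite lebesgue_itv// ltW.
have := null _ mD (@subDsetl _ _ _); have := mass_setID _ O mI mO.
by rewrite -cumulB ?ltW// (setIC _ O); move: lE h1 h2; rewrite /leb_portion; lra.
Qed.

Lemma profile_boundary_between r s : 0 < r -> r < s -> s < 1 ->
  0 < profile_mass s - profile_mass r < s - r ->
  exists2 t, profile_boundary t & r < t < s.
Proof.
move=> r0 rs s1; rewrite profile_massB ?ltW// => h.
have r01 : 0 < r < 1 by lra.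
have s01 : 0 < s < 1 by lra.
have [[Ir Fr] [Is Fs]] := (quantile_in _ r01, quantile_in _ s01).
have qrs := quantile_lt _ _ r01 s01 rs.
have [|x bx /andP[rx xs]] := essential_boundary_between O mO _ _ qrs.
  by apply: mass_portion_mixed => //; rewrite Fr Fs.
have Ix : I x by apply: (open_interval_conv a b _ _ _ Ir Is); exact: ltW.
exists (F x); first by split; [exact: cumul_interior|rewrite quantileK].
by rewrite -{1}Fr -Fs !cumul_lt.
Qed.

Lemma perimeter_ge_sum (xs : seq R) : uniq xs -> (forall x, x \in xs -> essential_boundary O x) ->
  ((\sum_(x <- xs) f x)%:E <= perimeter f O)%E.
Proof.
move=> uxs bxs; apply: esum_ge; exists [set` xs];
  first by split=> [|x /= /bxs//]; exact: finite_seq.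
by rewrite -fsbig_seq// -sumEFin.
Qed.

Lemma boundary_sum_perimeter T : boundary_sum_ge J profile_boundary T ->
  (T%:E <= perimeter f O)%E.
Proof.
case=> ts [uts Dts Tts]; apply: le_trans (perimeter_ge_sum (map q ts) _ _).
- rewrite lee_fin (le_trans Tts)// big_map !big_seq le_eqVlt; apply/orP; left; apply/eqP.
  by apply: eq_bigr => t /Dts[t01 _]; rewrite iso_profileE.
- rewrite map_inj_in_uniq// => r s /Dts[r01 _] /Dts[s01 _] qrs.
  by rewrite -(quantile_in _ r01).2 qrs (quantile_in _ s01).2.
- by move=> x /mapP[t /Dts[_ bt] ->].
Qed.

(** [J] is at least [J c] on [[c, 1 - c]], so an infinite number of boundary
    points there would make the perimeter infinite. *)
Lemma profile_boundary_finite c : (perimeter f O < +oo)%E -> 0 < c -> c <= 2^-1 ->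
  finite_set (profile_boundary `&` [set t | c <= t <= 1 - c]).
Proof.
move=> Poo c0 c2; apply: contrapT => /infinite_set_fset inf.
have Jc : 0 < J c by apply: iso_profile_gt0; lra.
have P0 : (0 <= perimeter f O)%E by apply: esum_ge0 => x _; rewrite lee_fin f_ge0.
pose n := (Num.truncn (fine (perimeter f O) / J c)).+1.
have [B BD nB] := inf n.
have : boundary_sum_ge J profile_boundary (\sum_(t <- B) J t)%R.
  by exists B; split=> [||//]; [exact: fset_uniq|move=> t tB; case: (BD t tB)].
move/boundary_sum_perimeter; rewrite -[perimeter f O]fineK ?ge0_fin_numE// lee_fin leNgt.
move/negP; apply; apply: (@lt_le_trans _ _ (n%:R * J c)).
  by rewrite -ltr_pdivrMr//; exact: truncnS_gt.
have : \sum_(t <- B) J c <= \sum_(t <- B) J t.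
  rewrite !big_seq; apply: ler_sum => t /BD[[t01 _] /= ct].
  by apply: (concave_symmetric_le J iso_profile_concave_symmetric); lra.
apply: le_trans; rewrite big_const_seq count_predT iter_addr_0.
by rewrite -[leRHS]mulr_natl ler_wpM2r ?ler_nat// ltW.
Qed.

Lemma profile_mass_set_profile : (perimeter f O < +oo)%E ->
  set_profile profile_mass profile_boundary.
Proof.
move=> Poo; split; [exact: profile_mass0|exact: profile_mass_lipschitz|
  exact: profile_boundary_between|].
move=> t t01; pose c := Num.min t (1 - t) / 2.
have c0 : 0 < c by rewrite divr_gt0// lt_min; lra.
have ct : c * 2 <= t /\ c * 2 <= 1 - t by rewrite /c divfK// !ge_min !lexx orbT.
have [|d d0 hd] := finite_set_isolated _ t (profile_boundary_finite c Poo c0 _); first lra.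
exists (Num.min c d); first by rewrite lt_min c0.
move=> u Du; rewrite lt_min => /andP[uc ud]; apply: hd => //; split=> //=.
by move: uc; rewrite ltr_norml; lra.
Qed.

(** Sets of the same mass have differences of the same mass. *)
Lemma mass_symm_diff (B : set (lebesgueType R)) : measurable B ->
  mass mu B = mass mu O -> mass mu (O `+` B) = 2 * (mass mu O - mass mu (O `&` B)).
Proof.
move=> mB BO.
rewrite /setY mass_setU; [|exact: measurableD|exact: measurableD|].
  have := mass_setID _ B mO mB; have := mass_setID _ O mB mO; rewrite (setIC B); lra.
by rewrite !setDE; apply/seteqP; split=> // x [[? ?] [? ?]].
Qed.

Lemma asymmetryE (M := mass mu O) : 0 < M < 1 ->
  asymmetry mu a b O = 2 * Num.min (M - profile_mass M) (profile_mass (1 - M)).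
Proof.
move=> M01; have M01' : 0 < 1 - M < 1 by lra.
have eqE r : 0 < r < 1 -> equantile mu a b r = (q r)%:E.
  by move=> r01; rewrite /equantile !ifN//; apply/eqP; lra.
rewrite /asymmetry -/M !eqE// minr_pMr//; congr Num.min.
  have -> : [set x | (x%:E < (q M)%:E)%E] = `]-oo, q M[%classic :> set R.
    by apply/seteqP; split=> x /=; rewrite in_itv/= lte_fin.
  have m1 : measurable (`]-oo, q M[%classic : set (lebesgueType R)).
    exact: measurable_lebesgue_itv.
  have half B : measurable B -> mass mu (B `&` `]-oo, q M]) = mass mu (B `&` `]-oo, q M[).
    move=> mB; rewrite -(@setUitv1 _ _ -oo%O (q M) true)// setIUr.
    have ms : measurable ([set q M] : set (lebesgueType R)).
      by apply: sub_caratheodory; exact: measurable_set1.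
    have mBs : measurable (B `&` [set q M]) by exact: measurableI.
    rewrite mass_setU//; last 2 first.
    - exact: measurableI.
    - by apply/seteqP; split=> // x [[_ /=]]; rewrite in_itv/= => xq [_ /= xE]; lra.
    have := le_mass _ _ mBs ms (@subIsetr _ _ _); rewrite mass_set1.
    have := mass_ge0 (B `&` [set q M]); lra.
  rewrite mass_symm_diff//.
    by rewrite -half// profile_massE.
  have := half _ measurableT; rewrite !setTI => <-.
  by have [_] := quantile_in _ M01.
have -> : [set x | ((q (1 - M))%:E < x%:E)%E] = `]q (1 - M), +oo[%classic :> set R.
  by apply/seteqP; split=> x /=; rewrite in_itv/= lte_fin andbT.
have m1 : measurable (`]-oo, q (1 - M)]%classic : set (lebesgueType R)).
  exact: measurable_lebesgue_itv.
rewrite mass_symm_diff; [|exact: measurable_lebesgue_itv|].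
  by rewrite profile_massE//; have := mass_portion_tail (q (1 - M)); lra.
rewrite -setCitvl mass_setC//; have [_] := quantile_in _ M01'; rewrite /cumul => ->.
by rewrite -/M; lra.
Qed.

(** If [mu O > 1 / 2], the bound is applied to [t - g t], the distribution function
    of the complement, with the same boundary. *)
Lemma perimeter_lower_bound (m := min_mass mu O) (l := asymmetry mu a b O / 2) :
  0 < l -> l <= m -> l <= (1 - m) / 2 -> ((optimal_sum J m l)%:E <= perimeter f O)%E.
Proof.
move=> l0 lm lm2; have [Poo|] := ltP (perimeter f O) +oo%E; last exact: le_trans (leey _).
have gP := profile_mass_set_profile Poo; have Jcs := iso_profile_concave_symmetric.
pose M := mass mu O.
have mE : m = Num.min M (1 - M) by [].
have m2 : m <= 2^-1 by rewrite mE ge_min; lra.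
have M01 : 0 < M < 1.
  have : 0 < m by lra.
  by rewrite mE lt_min; lra.
have lE : l = Num.min (M - profile_mass M) (profile_mass (1 - M)).
  by rewrite /l asymmetryE//; lra.
have [l1 l2] : l <= M - profile_mass M /\ l <= profile_mass (1 - M).
  by rewrite lE !ge_min !lexx orbT.
have ml : admissible m l by rewrite /admissible l0 lm m2 lm2.
have D01 : profile_boundary `<=` [set t | 0 <= t <= 1] by move=> t [t01 _] /=; lra.
apply: boundary_sum_perimeter.
have [M2|M2] := leP M (1 - M).
  have {}mE : m = M by rewrite mE; apply/min_idPl.
  by apply: (profile_lower_bound _ Jcs profile_mass) => //; rewrite ?profile_mass1 mE.
have {}mE : m = 1 - M by rewrite mE; apply/min_idPr/ltW.
apply: (profile_lower_bound _ Jcs _ _ _ _ D01 (set_profile_compl _ _ gP)) => //=.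
- by rewrite profile_mass1 mE.
- by rewrite mE; lra.
- by rewrite mE (_ : 1 - (1 - M) = M)//; lra.
Qed.

End Distribution.

(** * Sets with equality *)

Lemma perimeter_two_points O s t : s < t -> essential_boundary O = [set s; t] ->
  perimeter f O = (f s + f t)%:E.
Proof.
move=> st bO; rewrite /perimeter bO.
have -> : [set s; t] = [set` [:: s; t]].
  apply/seteqP; split=> x /=; rewrite !inE.
    by case=> ->; rewrite eqxx ?orbT.
  by case/orP=> /eqP ->; [left|right].
rewrite esum_fset; [|exact: finite_seq|by move=> x _; rewrite lee_fin f_ge0].
by rewrite -fsbig_seq/= ?inE ?lt_eqF// !big_cons big_nil adde0 EFinD.
Qed.

Lemma quantile_le r s : 0 < r < 1 -> 0 < s < 1 -> r <= s -> q r <= q s.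
Proof.
move=> r01 s01; rewrite le_eqVlt => /predU1P[->//|rs].
exact/ltW/quantile_lt.
Qed.

Lemma mass_quantile_itv r s : 0 < r < 1 -> 0 < s < 1 -> r <= s ->
  mass mu `]q r, q s] = s - r.
Proof.
move=> r01 s01 rs; rewrite -cumulB; last exact: quantile_le.
by rewrite (quantile_in _ r01).2 (quantile_in _ s01).2.
Qed.

Lemma profile_mass_itv (al be t : R) : 0 < al < 1 -> 0 < be < 1 -> al <= be -> 0 < t < 1 ->
  profile_mass `]q al, q be] t = Num.max 0 (Num.min be t - al).
Proof.
move=> al01 be01 ab t01; rewrite profile_massE//.
have [bt|tb] := leP be t.
  rewrite (_ : _ `&` _ = `]q al, q be]%classic) ?mass_quantile_itv//.
    by rewrite max_r// subr_ge0.
  apply: setIidl => x /=; rewrite !in_itv/= => /andP[_ /le_trans]; apply.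
  exact: quantile_le.
have [at_|ta] := leP al t.
  rewrite (_ : _ `&` _ = `]q al, q t]%classic) ?mass_quantile_itv//.
    by rewrite max_r// subr_ge0.
  apply/seteqP; split=> x /=; rewrite !in_itv/=; first by case=> /andP[-> _] ->.
  by case/andP=> -> xt; rewrite xt (le_trans xt)// quantile_le// ltW.
rewrite (_ : _ `&` _ = set0); first by rewrite /mass measure0 max_l// subr_le0 ltW.
apply/seteqP; split=> // x /=; rewrite !in_itv/= => -[/andP[ax _] xt].
by have := quantile_lt _ _ t01 al01 ta; lra.
Qed.

Lemma profile_massC O t : measurable O -> 0 < t < 1 ->
  profile_mass (~` O) t = t - profile_mass O t.
Proof.
move=> mO t01; rewrite !profile_massE//.
have mt := measurable_lebesgue_itv `]-oo, q t].
have [_] := quantile_in _ t01; rewrite /cumul => qt.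
have := mass_setID _ O mt mO; rewrite qt setDE (setIC _ O) (setIC _ (~` O)); lra.
Qed.

Lemma asymmetry_min_mass O (m l : R) : measurable O -> 0 < m -> m <= 2^-1 ->
  mass mu O = m -> Num.min (m - profile_mass O m) (profile_mass O (1 - m)) = l ->
  min_mass mu O = m /\ asymmetry mu a b O = 2 * l.
Proof.
move=> mO m0 m2 Om gl; split; first by rewrite /min_mass Om; apply/min_idPl; lra.
have M01 : 0 < mass mu O < 1 by rewrite Om; lra.
by have := asymmetryE O mO M01; rewrite /= Om gl.
Qed.

Lemma interval_optimal (m l : R) : 0 < l -> l <= m -> m <= 2^-1 -> l <= (1 - m) / 2 ->
  exists O : set (lebesgueType R), [/\ measurable O, min_mass mu O = m,
    asymmetry mu a b O = 2 * l & perimeter f O = (J (m + l) + J l)%:E].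
Proof.
move=> l0 lm m2 lm2; exists (`]q l, q (m + l)]%classic).
have l01 : 0 < l < 1 by lra.
have ml01 : 0 < m + l < 1 by lra.
have lml : l < m + l by lra.
have mO : measurable (`]q l, q (m + l)]%classic : set (lebesgueType R)).
  exact: measurable_lebesgue_itv.
have qlt := quantile_lt _ _ l01 ml01 lml.
have [||||-> ->] := asymmetry_min_mass `]q l, q (m + l)] m l mO => //; first lra.
- by rewrite mass_quantile_itv ?ltW//; lra.
- rewrite !profile_mass_itv ?ltW//; try lra.
  rewrite (min_r (_ : m <= m + l)); last lra.
  rewrite (max_r (_ : 0 <= m - l)); last lra.
  rewrite min_l; first lra.
  by rewrite le_max lerBrDr le_min; lra.
split=> //; rewrite (perimeter_two_points _ _ _ qlt) ?essential_boundary_itv//.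
by rewrite !iso_profileE// addrC.
Qed.

Lemma interval_complement_optimal (m l : R) : 0 < l -> l <= m / 2 -> m <= 2^-1 ->
  exists O : set (lebesgueType R), [/\ measurable O, min_mass mu O = m,
    asymmetry mu a b O = 2 * l & perimeter f O = (J (m - l) + J l)%:E].
Proof.
move=> l0 lm m2; pose O : set (lebesgueType R) := `]q (m - l), q (1 - l)]%classic.
exists (~` O).
have l01 : 0 < l < 1 by lra.
have l01' : 0 < 1 - l < 1 by lra.
have ml01 : 0 < m - l < 1 by lra.
have lml : m - l < 1 - l by lra.
have mO : measurable O by exact: measurable_lebesgue_itv.
have qlt := quantile_lt _ _ ml01 l01' lml.
have [||||-> ->] := asymmetry_min_mass (~` O) m l (measurableC mO) => //; first lra.
- by rewrite mass_setC// mass_quantile_itv ?ltW//; lra.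
- rewrite !profile_massC ?profile_mass_itv ?ltW//; try lra.
  rewrite (min_r (_ : m <= 1 - l)); last lra.
  rewrite (min_r (_ : 1 - m <= 1 - l)); last lra.
  rewrite (max_r (_ : 0 <= m - (m - l))); last lra.
  rewrite (max_r (_ : 0 <= 1 - m - (m - l))); last lra.
  by rewrite min_l; lra.
split=> //; first exact: measurableC.
rewrite (perimeter_two_points _ _ _ qlt) ?essential_boundary_itvC//.
by rewrite !iso_profileE// quantile_opp// f_symmetric.
Qed.

End SymmetricLogConcaveMeasure.

Theorem theorem2p6 (R : realType) (mu : probability (lebesgueType R) R)
    (f : R -> R) (a b : \bar R)
    (f_density : has_density mu f)
    (f_pos : forall x : R, open_interval a b x -> 0 < f x)
    (f_zero : forall x : R, ~ open_interval a b x -> f x = 0)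
    (f_log_concave : log_concave_on a b f)
    (f_symmetric : forall x : R, f (- x) = f x) :
  [/\ (forall Omega : set (lebesgueType R), measurable Omega ->
        0 < asymmetry mu a b Omega -> asymmetry mu a b Omega <= min_mass mu Omega ->
        ((iso_profile mu f a b (min_mass mu Omega - asymmetry mu a b Omega / 2)
          + iso_profile mu f a b (asymmetry mu a b Omega / 2))%:E
         <= perimeter f Omega)%E),
      (forall Omega : set (lebesgueType R), measurable Omega ->
        min_mass mu Omega < asymmetry mu a b Omega ->
        asymmetry mu a b Omega
          <= Num.min (2 * min_mass mu Omega) (1 - min_mass mu Omega) ->
        ((iso_profile mu f a b (min_mass mu Omega + asymmetry mu a b Omega / 2)
          + iso_profile mu f a b (asymmetry mu a b Omega / 2))%:E
         <= perimeter f Omega)%E),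
      (forall m lambda : R, 0 < m -> m <= 1 / 2 -> 0 < lambda -> lambda <= m ->
        exists Omega : set (lebesgueType R),
          [/\ measurable Omega, min_mass mu Omega = m,
              asymmetry mu a b Omega = lambda &
              perimeter f Omega
              = (iso_profile mu f a b (m - lambda / 2)
                 + iso_profile mu f a b (lambda / 2))%:E]) &
      (forall m lambda : R, 0 < m -> m <= 1 / 2 -> m < lambda ->
        lambda <= Num.min (2 * m) (1 - m) ->
        exists Omega : set (lebesgueType R),
          [/\ measurable Omega, min_mass mu Omega = m,
              asymmetry mu a b Omega = lambda &
              perimeter f Omega
              = (iso_profile mu f a b (m + lambda / 2)
                 + iso_profile mu f a b (lambda / 2))%:E])].
Proof.
have lower := perimeter_lower_bound mu f a b f_density f_pos f_zero f_log_concave f_symmetric.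
have m2 (O : set (lebesgueType R)) : min_mass mu O <= 2^-1.
  by rewrite /min_mass ge_min; lra.
split.
- move=> O mO l0 lm; have := lower O mO; rewrite /optimal_sum.
  have -> : asymmetry mu a b O / 2 <= min_mass mu O / 2 by lra.
  by apply; have := m2 O; lra.
- move=> O mO lm; rewrite le_min => /andP[l2m l1m].
  have := lower O mO; rewrite /optimal_sum.
  have -> : (asymmetry mu a b O / 2 <= min_mass mu O / 2) = false.
    by apply/negbTE; rewrite -ltNge; lra.
  by apply; lra.
- move=> m l m0 m2' l0 lm.
  have [||| O [mO mE lE PE]] := interval_complement_optimal mu f a b f_density f_pos
    f_zero f_log_concave f_symmetric m (l / 2); try lra.
  by exists O; split=> //; rewrite lE; lra.
- move=> m l m0 m2' lm; rewrite le_min => /andP[l2m l1m].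
  have [|||| O [mO mE lE PE]] := interval_optimal mu f a b f_density f_pos
    f_zero f_log_concave f_symmetric m (l / 2); try lra.
  by exists O; split=> //; rewrite lE; lra.
Qed.
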